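(* Let $B = (V,E)$ be a Bratteli diagram of rank $k \geq 2$; identify $V_n$ with $\{1, \dots ,k\}$ for any $n \geq 1$. Let $F_n = (f_{i,j}^{(n)})$ be the sequence of incidence matrices of $B$, and suppose that $\sum_{j \in V_n} f_{i,j}^{(n)} = r_n \geq 2$ for every $i \in V_{n+1}$, and that $\operatorname{rank} F_n = k$ for all $n\ge1$. Denote $$z^{(n)} = \det \begin{pmatrix} \dfrac{f_{1,1}^{(n)}}{r_n} & \ldots & \dfrac{f_{1,{k-1}}^{(n)}}{r_n} & 1\\ \vdots & \ddots & \vdots & \vdots\\ \dfrac{f_{{k},1}^{(n)}}{r_n} & \ldots & \dfrac{f_{{k},{k-1}}^{(n)}}{r_n} & 1 \end{pmatrix}.$$ Then there exist exactly $k$ ergodic invariant measures on $B$ if and only if $$\prod_{n = 1}^{\infty} |z^{(n)}| > 0,$$ or, equivalently, $$\sum_{n = 1}^{\infty}(1 - |z^{(n)}|) < \infty.$$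
   Context: A Bratteli diagram $B=(V,E)$ is an infinite graph with $V=\bigcup_{i\ge 0}V_i$, $E=\bigcup_{i\ge1}E_i$ (disjoint finite levels, $V_0=\{v_0\}$), with range and source maps $r,s$ on edges such that $r(E_i)=V_i$, $s(E_i)=V_{i-1}$, $s^{-1}(v)\ne\emptyset$ for all $v$, and $r^{-1}(v)\neq\emptyset$ for all $v\ne v_0$. The $n$-th incidence matrix is $F_n=(f^{(n)}_{v,w})_{v\in V_{n+1},w\in V_n}$, where $f^{(n)}_{v,w}$ is the number of edges from $w$ to $v$. Here every level $V_n$, $n\ge 1$, has exactly $k$ vertices, so $F_n$ is $k\times k$ for $n\ge1$; the equal row sum convention also includes $F_0=(r_0,\dots,r_0)^T$. $X_B$ is the space of infinite paths starting at $v_0$ with the cylinder topology, assumed to be a Cantor set. Two paths are tail equivalent, $(x,y)\in\mathcal E$, if they agree from some index on. ''Invariant measure on $B$'' means an $\mathcal E$-invariant probability Borel measure on $X_B$, i.e. one giving equal measure to any two cylinder sets defined by finite paths from $v_0$ to the same vertex; ergodic means ergodic with respect to $\mathcal E$. *)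

(* Defs.v *)
From HB Require Import structures.
From mathcomp Require Import all_boot all_order all_algebra.
From mathcomp Require Import all_classical all_reals all_analysis.

Set Implicit Arguments.
Unset Strict Implicit.
Unset Printing Implicit Defensive.

Import Order.TTheory GRing.Theory Num.Theory.

Local Open Scope classical_set_scope.
Local Open Scope ring_scope.

(* [edges n] is the set E_(n+1) of edges between the levels V_n and V_(n+1). *)
Record bratteli := Bratteli {
  level : nat -> finType;
  edges : nat -> finType;
  src : forall n, edges n -> level n;
  rng : forall n, edges n -> level n.+1;
  card_level0 : #|level 0| = 1%N;
  src_surj : forall n (v : level n), exists e : edges n, src e = v;
  rng_surj : forall n (v : level n.+1), exists e : edges n, rng e = v }.

(* f^(n)_(v,w): the number of edges from w to v. *)
Definition incidence (B : bratteli) (n : nat)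
    (v : level B n.+1) (w : level B n) : nat :=
  #|[pred e : edges B n | (rng e == v) && (src e == w)]|.

(* Level 0 being a single vertex, every path starts at v_0. *)
Record path_space (B : bratteli) := BPath {
  edge : forall n, edges B n;
  edge_compat : forall n, src (edge n.+1) = rng (edge n) }.

Section PathSpace.
Variable B : bratteli.

Lemma path_exists : exists x : path_space B, True.
Proof.
have [v _] : exists v : level B 0, true.
  by have /card_gt0P[v _] : (0 < #|level B 0|)%N; [rewrite card_level0 | exists v].
have next n (w : level B n) : {e : edges B n | src e = w}.
  by apply: cid; apply: src_surj.
pose fix st n : edges B n :=
  if n is m.+1 then sval (next m.+1 (rng (st m))) else sval (next 0%N v).
by exists (@BPath B st (fun n => svalP (next n.+1 (rng (st n))))).
Qed.

HB.instance Definition _ := gen_eqMixin (path_space B).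
HB.instance Definition _ := gen_choiceMixin (path_space B).
HB.instance Definition _ := isPointed.Build (path_space B) (sval (cid path_exists)).

(* The topology generated by the cylinder sets is the one induced by the
   product of the discrete edge sets. *)
Definition path_to_prod (x : path_space B) :
  prod_topology (fun n => discrete_topology (edges B n)) := edge x.

HB.instance Definition _ :=
  Topological.copy (path_space B) (initial_topology path_to_prod).

Definition path_borel := g_sigma_algebraType (@open (path_space B)).

HB.instance Definition _ := Measurable.on path_borel.

Definition path_vertex (x : path_space B) (n : nat) : level B n :=
  if n is m.+1 then rng (edge x m) else src (edge x 0).

(* The cylinder set of the finite path formed by the first n edges of x; every
   finite path from v_0 arises in this way, since all s^-1(v) are nonempty. *)
Definition cylinder (x : path_space B) (n : nat) : set (path_space B) :=
  [set y | forall i, (i < n)%N -> edge y i = edge x i].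

Definition tail_equiv (x y : path_space B) : Prop :=
  exists N, forall n, (N <= n)%N -> edge x n = edge y n.

Definition tail_invariant_set (A : set (path_space B)) : Prop :=
  forall x y, tail_equiv x y -> A x -> A y.

End PathSpace.

Section Measures.
Variables (R : realType) (B : bratteli).
Local Open Scope ereal_scope.

Definition invariant_measure (mu : probability (path_borel B) R) : Prop :=
  forall n (x y : path_space B), path_vertex x n = path_vertex y n ->
    mu (cylinder x n) = mu (cylinder y n).

Definition ergodic_measure (mu : probability (path_borel B) R) : Prop :=
  forall A : set (path_borel B), measurable A -> tail_invariant_set A ->
    mu A = 0 \/ mu A = 1.

(* A [probability] is a function on all sets, with unspecified values outside
   the sigma-algebra, so measures are compared on measurable sets only. *)
Definition same_measure (mu nu : probability (path_borel B) R) : Prop :=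
  forall A : set (path_borel B), measurable A -> mu A = nu A.

Definition exactly_ergodic_invariant (k : nat) : Prop :=
  exists mu : 'I_k -> probability (path_borel B) R,
    [/\ forall i, invariant_measure (mu i) /\ ergodic_measure (mu i),
        forall i j, same_measure (mu i) (mu j) -> i = j &
        forall nu, invariant_measure nu -> ergodic_measure nu ->
          exists i, same_measure nu (mu i)].

End Measures.

(* F_n as a k x k matrix over R, for the identifications [lbl n] of 'I_k with
   the n-th level; only meaningful for n >= 1. *)
Definition incidence_mx (R : realType) (B : bratteli) (k : nat)
    (lbl : forall n, 'I_k -> level B n) (n : nat) : 'M[R]_k :=
  \matrix_(i, j) (incidence (lbl n.+1 i) (lbl n j))%:R.

Definition z_det (R : realType) (B : bratteli) (k : nat)
    (lbl : forall n, 'I_k -> level B n) (r : nat -> nat) (n : nat) : R :=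
  \det (\matrix_(i < k, j < k)
    if j.+1 == k then 1 else incidence_mx R lbl n i j / (r n)%:R).

(* Main.v *)
Require Import Defs.
From HB Require Import structures.
From mathcomp Require Import all_boot all_order all_algebra.
From mathcomp Require Import all_classical all_reals all_analysis.
From mathcomp Require Import perm ring lra.

Set Implicit Arguments.
Unset Strict Implicit.
Unset Printing Implicit Defensive.

Import Order.TTheory GRing.Theory Num.Theory.
Import numFieldNormedType.Exports.

Local Open Scope classical_set_scope.
Local Open Scope ring_scope.

(** Put [P_n = F_n / r_n].  The rows of this matrix sum to [1], so the column of
    ones in the definition of [z^(n)] is the sum of the columns of [P_n], and
    [z^(n) = det P_n]: by the rank hypothesis and stochasticity its absolute
    value lies in the interval from [0] (excluded) to [1].

    A vertex of level [n] is reached by [r_0 ... r_(n-1)] paths whatever the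
    vertex.  Hence a finite invariant measure amounts to the sequence of its
    distributions [q_n] on the levels, subject to [q_n = q_(n+1) P_n], and as
    the [P_n] are invertible it is determined, linearly, by [q_1].  Let
    [A_n = P_n ... P_1] ([descent]); then [q_1 = q_(n+1) A_n], and [|det A_n|]
    is the partial product of the [|z^(j)|].

    Suppose that the product is positive.  A limit point [A] of the sequence
    [A_n] is then invertible, and every [q_1] is [t A], where [t] is a limit
    point of the [q_n].  So the invariant probability measures form a simplex
    whose [k] vertices are the measures given by the rows of [A]; these exist
    because weights on the vertices that are consistent along the edges define
    a measure ([weights_probability]).  The vertices of such a simplex are
    exactly the ergodic measures ([simplex_exactly_ergodic]).

    Conversely, distinct ergodic measures are told apart by tail invariant sets
    ([ergodic_separated]), hence are linearly independent, and so are their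
    distributions on level [1].  For [k] of them these distributions are the
    rows of an invertible matrix [M = M_n A_n], where [M_n], whose rows are the
    distributions on level [n + 1], is stochastic.  As [|det M_n| <= 1],
    the partial products [|det A_n|] stay above [|det M| > 0].

    The equivalence with the convergence of the series is a general fact about
    sequences in the interval from [0] (excluded) to [1] ([prod_cvg_posP]). *)

(** * Infinite products of numbers of the unit interval *)

Section Products.
Variable R : realType.
Implicit Type a : nat -> R.

Lemma prodr_in01_nonincreasing m a :
  (forall n, (m <= n)%N -> 0 <= a n <= 1) ->
  nonincreasing_seq (fun N => \prod_(m <= n < N) a n).
Proof.
move=> a01; apply/nonincreasing_seqP => N.
have [mN|Nm] := leqP m N; last by rewrite !big_geq // ltnW.
rewrite big_nat_recr //=; have /andP[aN0 aN1] := a01 _ mN.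
rewrite ler_piMr // big_nat_cond; apply: prodr_ge0 => i.
by rewrite andbT => /andP[/a01/andP[]].
Qed.

Lemma prod_cvg_pos m a (c : R) :
  (forall n, (m <= n)%N -> 0 <= a n <= 1) -> 0 < c ->
  (forall N, c <= \prod_(m <= n < N) a n) ->
  exists2 p : R, 0 < p & (\prod_(m <= n < N) a n) @[N --> \oo] --> p.
Proof.
move=> a01 c0 ca.
have ni := prodr_in01_nonincreasing a01.
have cv : cvgn (fun N => \prod_(m <= n < N) a n).
  by apply: nonincreasing_is_cvgn => //; exists c => _ [N _ <-].
exists (limn (fun N => \prod_(m <= n < N) a n)); last exact: cv.
apply: lt_le_trans c0 _; apply: limr_ge => //.
by apply: nearW.
Qed.

Lemma prod_le_cvg m a p N :
  (forall n, (m <= n)%N -> 0 <= a n <= 1) ->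
  (\prod_(m <= n < N) a n) @[N --> \oo] --> p -> p <= \prod_(m <= n < N) a n.
Proof.
move=> a01 cp; rewrite -(cvg_lim _ cp)//.
apply: nonincreasing_cvgn_ge; first exact: prodr_in01_nonincreasing.
by apply/cvg_ex; exists p.
Qed.

(** Induction on [N]: the step multiplies the left-hand side by at most
    [a * (1 + (1 - a)) <= 1]. *)
Lemma prod_mul_sum_le1 m a N :
  (forall n, (m <= n)%N -> 0 <= a n <= 1) ->
  (\prod_(m <= n < N) a n) * (1 + \sum_(m <= n < N) (1 - a n)) <= 1.
Proof.
move=> a01; elim: N => [|N IH]; first by rewrite !big_geq // addr0 mulr1.
have [mN|Nm] := leqP m N; last by rewrite !big_geq // addr0 mulr1.
rewrite !big_nat_recr //=; have /andP[aN0 aN1] := a01 _ mN.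
apply: le_trans IH; rewrite -mulrA ler_wpM2l //.
  rewrite big_nat_cond; apply: prodr_ge0 => i.
  by rewrite andbT => /andP[/a01/andP[]].
have : 0 <= \sum_(m <= n < N) (1 - a n).
  rewrite big_nat_cond; apply: sumr_ge0 => i.
  by rewrite andbT => /andP[/a01/andP[_]]; rewrite subr_ge0.
move: (\sum_(m <= n < N) (1 - a n)) => S S0.
have -> : 1 + (S + (1 - a N)) = 1 + S + (1 - a N) by lra.
have : 0 <= (1 - a N) * S by apply: mulr_ge0 => //; lra.
have : 0 <= (1 - a N) * (1 - a N) by apply: mulr_ge0 => //; lra.
nra.
Qed.

Lemma sum_compl_ge_prod m a N :
  (forall n, (m <= n)%N -> 0 <= a n <= 1) ->
  1 - \sum_(m <= n < N) (1 - a n) <= \prod_(m <= n < N) a n.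
Proof.
move=> a01; elim: N => [|N IH]; first by rewrite !big_geq // subr0.
have [mN|Nm] := leqP m N; last by rewrite !big_geq // subr0.
rewrite !big_nat_recr //=; have /andP[aN0 aN1] := a01 _ mN.
have P1 : \prod_(m <= n < N) a n <= 1.
  rewrite big_nat_cond; apply: prodr_ile1 => i.
  by rewrite andbT => /andP[/a01].
have : 0 <= (1 - a N) * (1 - \prod_(m <= n < N) a n).
  by apply: mulr_ge0; lra.
nra.
Qed.

(** A limit [p] of the products bounds the partial sums by [1 / p - 1]
    ([prod_mul_sum_le1]); conversely, once a tail of the series is less than
    [1 / 2], the corresponding tail of the product is at least [1 / 2]
    ([sum_compl_ge_prod]). *)
Lemma prod_cvg_posP m a : (forall n, (m <= n)%N -> 0 < a n <= 1) ->
  (exists2 p : R, 0 < p & (\prod_(m <= n < N) a n) @[N --> \oo] --> p) <->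
  cvgn (fun N => \sum_(m <= n < N) (1 - a n)).
Proof.
move=> a01'.
have a01 n : (m <= n)%N -> 0 <= a n <= 1.
  by move=> /a01'/andP[/ltW -> ->].
have nd j : (m <= j)%N ->
    nondecreasing_seq (fun N => \sum_(j <= n < N) (1 - a n)).
  move=> mj; apply/nondecreasing_seqP => N.
  have [jN|Nj] := leqP j N; last by rewrite !big_geq // ltnW.
  rewrite big_nat_recr //= lerDl subr_ge0.
  by have /andP[] := a01 _ (leq_trans mj jN).
split=> [[p p0 cp]|cs].
  apply: nondecreasing_is_cvgn; first exact: nd.
  exists (p^-1) => _ [N _ <-].
  have H1 := prod_mul_sum_le1 N a01.
  have H2 := prod_le_cvg N a01 cp.
  have S0 : 0 <= \sum_(m <= n < N) (1 - a n).
    rewrite big_nat_cond; apply: sumr_ge0 => i.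
    by rewrite andbT => /andP[/a01/andP[_]]; rewrite subr_ge0.
  have : p * (1 + \sum_(m <= n < N) (1 - a n)) <= 1.
    by apply: le_trans H1; apply: ler_wpM2r => //; lra.
  rewrite mulrC -ler_pdivlMr // div1r => H; lra.
pose S := limn (fun N => \sum_(m <= n < N) (1 - a n)).
have half0 : 0 < (2^-1 : R) by rewrite invr_gt0 ltr0n.
have /cvgrPdist_lt/(_ _ half0)[N0 _ HN0] :
    (fun N => \sum_(m <= n < N) (1 - a n)) @ \oo --> S by exact: cs.
pose M := maxn m N0.
have mM : (m <= M)%N by rewrite leq_maxl.
have SM N : \sum_(m <= n < N) (1 - a n) <= S.
  by apply: nondecreasing_cvgn_le => //; exact: nd.
have tail N : 2^-1 <= \prod_(M <= n < N) a n.
  have aM n : (M <= n)%N -> 0 <= a n <= 1.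
    by move=> /(leq_trans mM)/a01.
  apply: le_trans (sum_compl_ge_prod N aM).
  have [MN|NM] := leqP M N; last by rewrite big_geq ?(ltnW NM)//; lra.
  have := SM N; rewrite (@big_cat_nat _ _ _ M) //=.
  have := HN0 M (leq_maxr _ _); rewrite /= ger0_norm; last by rewrite subr_ge0.
  lra.
apply: (@prod_cvg_pos _ _ ((\prod_(m <= n < M) a n) * 2^-1)) => //.
  apply: mulr_gt0 => //; rewrite big_nat_cond; apply: prodr_gt0 => i.
  by rewrite andbT => /andP[/a01'/andP[]].
move=> N; have P0 k : 0 <= \prod_(m <= n < k) a n.
  rewrite big_nat_cond; apply: prodr_ge0 => i.
  by rewrite andbT => /andP[/a01/andP[]].
have [MN|NM] := leqP M N.
  by rewrite [leRHS](@big_cat_nat _ _ _ M) //= ler_wpM2l.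
have H : \prod_(m <= n < M) a n <= \prod_(m <= n < N) a n.
  by apply: prodr_in01_nonincreasing => //; exact: ltnW.
have := P0 M; nra.
Qed.

End Products.

(** * Determinants of stochastic matrices *)

Section Stochastic.
Variables (R : realType) (k : nat).
Implicit Types (A P : 'M[R]_k) (m n : nat).

Definition stochastic A :=
  (forall i j, 0 <= A i j) /\ (forall i, \sum_j A i j = 1).

(** The product of the row sums, [1], is the sum of the products
    [\prod_i A i (f i)] over all maps [f], of which the Leibniz formula keeps,
    up to signs, only those with [f] a permutation. *)
Lemma stochastic_det_le1 A : stochastic A -> `|\det A| <= 1.
Proof.
move=> [A0 A1].
have -> : 1 = \prod_(i < k) \sum_j A i j by rewrite big1.
rewrite bigA_distr_bigA /= /determinant.
apply: le_trans (ler_norm_sum _ _ _) _.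
rewrite (eq_bigr (fun s : 'S_k => \prod_i A i (s i))); last first.
  move=> s _; rewrite normrM normrX normrN1 expr1n mul1r ger0_norm //.
  exact: prodr_ge0.
pose F (f : {ffun 'I_k -> 'I_k}) := \prod_i A i (f i).
have -> : \sum_(s : 'S_k) \prod_i A i (s i) =
    \sum_(f : {ffun 'I_k -> 'I_k} | f \in codom (@pval _)) F f.
  rewrite (eq_bigr (fun s : 'S_k => F (pval s))); last first.
    by move=> s _; apply: eq_bigr => i _; rewrite -pvalE.
  rewrite -[RHS]big_filter.
  rewrite -(big_map (@pval _) xpredT F); apply: perm_big.
  apply: uniq_perm; rewrite ?filter_uniq ?index_enum_uniq //.
    by rewrite map_inj_uniq ?index_enum_uniq //; exact: val_inj.
  move=> f; rewrite mem_filter mem_index_enum andbT.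
  by rewrite /codom /image_mem enumT.
rewrite [leLHS]big_mkcond /=; apply: ler_sum => f _; case: ifP => // _.
exact: prodr_ge0.
Qed.

Lemma stochastic1 : stochastic 1%:M.
Proof.
split=> [i j|i]; first by rewrite mxE ler0n.
rewrite (bigD1 i) //= mxE eqxx big1 ?addr0 // => j ij.
by rewrite mxE eq_sym (negPf ij).
Qed.

Lemma stochasticM A P : stochastic A -> stochastic P -> stochastic (A *m P).
Proof.
move=> [A0 A1] [P0 P1]; split=> [i j|i].
  by rewrite mxE sumr_ge0 // => l _; rewrite mulr_ge0.
under eq_bigr do rewrite mxE.
rewrite exchange_big /= -[RHS](A1 i); apply: eq_bigr => l _.
by rewrite -mulr_sumr P1 mulr1.
Qed.

(** The ones in the last column are the sum of all the columns, so that the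
    matrix is [P] times a triangular matrix with unit diagonal. *)
Lemma det_last_col1 P : (forall i, \sum_j P i j = 1) ->
  \det (\matrix_(i < k, j < k) if j.+1 == k then 1 else P i j) = \det P.
Proof.
move=> P1.
pose U : 'M[R]_k := \matrix_(l, j) if j.+1 == k then 1 else (l == j)%:R.
have -> : (\matrix_(i < k, j < k) if j.+1 == k then 1 else P i j) = P *m U.
  apply/matrixP => i j; rewrite !mxE; under eq_bigr do rewrite mxE.
  case: ifP => jk; first by under eq_bigr do rewrite mulr1.
  rewrite (bigD1 j) //= eqxx mulr1 big1 ?addr0 // => l lj.
  by rewrite (negPf lj) mulr0.
suff U1 : \det U = 1 by rewrite det_mulmx U1 mulr1.
rewrite -det_tr det_trig.
  by rewrite big1 // => i _; rewrite !mxE eqxx; case: ifP.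
apply/is_trig_mxP => i j ij; rewrite !mxE; case: ifP => [/eqP ik|_].
  by have := leq_ltn_trans ij (ltn_ord j); move: ik => {1}->; rewrite ltnn.
by case: eqP => // ji; move: ij; rewrite ji ltnn.
Qed.

End Stochastic.

(** * Paths, cylinders and the topology of the path space *)

Section Paths.
Variable B : bratteli.
Implicit Types (x y z : path_space B) (n : nat).

Lemma path_eqP x y : (forall i, edge x i = edge y i) -> x = y.
Proof.
case: x y => [ex cx] [ey cy] /= exy.
have E : ex = ey by apply: functional_extensionality_dep.
by subst ey; congr BPath; exact: Prop_irrelevance.
Qed.

Lemma level0_eq (v w : level B 0) : v = w.
Proof.
have /eqP/fintype1P[a Ha] := card_level0 B.
by rewrite (Ha v) (Ha w).
Qed.

(** Beyond level [n] follow any edge: every vertex emits one. *)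
Lemma finite_path_extends (s : forall i, edges B i) n :
  (forall i, (i < n)%N -> src (s i.+1) = rng (s i)) ->
  exists x, forall i, (i <= n)%N -> edge x i = s i.
Proof.
move=> sP.
have next m (w : level B m) : {e : edges B m | src e = w}.
  by apply: cid; apply: src_surj.
pose fix st i : edges B i :=
  if i is m.+1 then
    if (m < n)%N then s m.+1 else sval (next m.+1 (rng (st m)))
  else s 0%N.
have stE i : (i <= n)%N -> st i = s i by case: i => //= i ->.
have stP i : src (st i.+1) = rng (st i).
  rewrite [st i.+1]/=; case: ifP => [lt_in|_]; last first.
    exact: (svalP (next i.+1 (rng (st i)))).
  by rewrite sP // stE // ltnW.
by exists (BPath stP) => i /stE.
Qed.

Definition ext_spec x n (e : edges B n) y :=
  [/\ (forall i, (i < n)%N -> edge y i = edge x i) & edge y n = e].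

Lemma ext_exists x n (e : edges B n) : src e = path_vertex x n ->
  exists y, ext_spec x e y.
Proof.
move=> se; pose s := dfwith (edge x) n e.
have sn : s n = e by rewrite /s dfwithin.
have si i : (i < n)%N -> s i = edge x i.
  by move=> lt_in; rewrite /s dfwithout // neq_ltn lt_in orbT.
have [|y yP] := @finite_path_extends s n; last first.
  exists y; split => [i lt_in|]; last by rewrite yP.
  by rewrite yP ?si // ltnW.
move=> i; rewrite leq_eqVlt => /orP[/eqP E|lt_in].
  subst n; rewrite sn (si i) //.
by rewrite !si ?edge_compat // ltnW.
Qed.

(** A path of the cylinder of [x] of length [n] that continues with [e]; the
    default [x] is taken when [e] does not start where [x] has arrived. *)
Definition ext x n (e : edges B n) : path_space B :=
  if pselect (exists y, ext_spec x e y) is left H then sval (cid H) else x.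

Lemma extP x n (e : edges B n) : src e = path_vertex x n ->
  ext_spec x e (ext x e).
Proof.
move=> /ext_exists H; rewrite /ext; case: pselect => // H'.
exact: (svalP (cid H')).
Qed.

Lemma splice_exists x n z : path_vertex x n = path_vertex z n ->
  exists y, forall i, edge y i = if (i < n)%N then edge x i else edge z i.
Proof.
move=> xz; pose s i := if (i < n)%N then edge x i else edge z i.
suff sP i : src (s i.+1) = rng (s i) by exists (BPath sP).
rewrite /s; case: (ltngtP i.+1 n) => [lt_in|lt_ni|E].
- by rewrite edge_compat.
- by rewrite edge_compat.
- by subst n; rewrite edge_compat -[rng _]/(path_vertex z i.+1) -xz.
Qed.

(** These exchanges of initial segments generate tail equivalence.  Being the
    identity on the paths that do not visit the vertex of [x] at level [n], they
    are total functions. *)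
Definition splice x n z : path_space B :=
  if pselect (path_vertex x n = path_vertex z n) is left H
  then sval (cid (splice_exists H)) else z.

Lemma edge_splice x n z i : path_vertex x n = path_vertex z n ->
  edge (splice x n z) i = if (i < n)%N then edge x i else edge z i.
Proof.
move=> xz; rewrite /splice; case: pselect => // H.
exact: (svalP (cid (splice_exists H))).
Qed.

Lemma splice_id x n z : path_vertex x n <> path_vertex z n ->
  splice x n z = z.
Proof. by rewrite /splice; case: pselect. Qed.

Lemma path_vertex_agree x y n :
  (forall i, (i < n)%N -> edge x i = edge y i) ->
  path_vertex x n = path_vertex y n.
Proof.
case: n => [_|n xy] /=; first exact: level0_eq.
by rewrite xy.
Qed.

Lemma cylinder_sym x y n : cylinder x n y -> cylinder y n x.
Proof. by move=> xy i /xy. Qed.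

Lemma cylinder_trans x y z n : cylinder x n y -> cylinder y n z ->
  cylinder x n z.
Proof. by move=> xy yz i lt_in; rewrite yz // xy. Qed.

Lemma cylinder_le x m n : (m <= n)%N -> cylinder x n `<=` cylinder x m.
Proof. by move=> mn y xy i lt_im; apply: xy; exact: leq_trans mn. Qed.

Lemma cylinder0 x : cylinder x 0 = setT.
Proof. by apply/seteqP; split. Qed.

Lemma cylinder_vertex x y n : cylinder x n y ->
  path_vertex y n = path_vertex x n.
Proof. exact: path_vertex_agree. Qed.

Lemma cylinder_ext x n (e : edges B n) : src e = path_vertex x n ->
  cylinder x n (ext x e).
Proof. by move=> /extP[]. Qed.

Lemma path_vertex_ext x n (e : edges B n) : src e = path_vertex x n ->
  path_vertex (ext x e) n.+1 = rng e.
Proof. by move=> /extP[_ /= ->]. Qed.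

Lemma src_edge y n : src (edge y n) = path_vertex y n.
Proof. by case: n => // n; rewrite edge_compat. Qed.

Lemma cylinder_extE x n (e : edges B n) y : src e = path_vertex x n ->
  cylinder (ext x e) n.+1 y <-> cylinder x n y /\ edge y n = e.
Proof.
move=> /extP[e1 e2]; split => [H|[xy ye] i].
  by split => [i lt_in|]; rewrite H // ?e1 //; exact: ltnW.
by rewrite ltnS leq_eqVlt => /orP[/eqP->|lt_in]; rewrite ?e2 // e1 // xy.
Qed.

Lemma cylinder_splice x n z : path_vertex x n = path_vertex z n ->
  cylinder x n (splice x n z).
Proof. by move=> xz i lt_in; rewrite edge_splice // lt_in. Qed.

Lemma path_through n (v : level B n) : exists x, path_vertex x n = v.
Proof.
elim: n v => [|n IH] v; first by exists point; exact: level0_eq.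
have [e ev] := rng_surj v; have [x xs] := IH (src e).
by exists (ext x e); rewrite path_vertex_ext.
Qed.

Definition determined n (E : set (path_space B)) :=
  forall x y, cylinder x n y -> E x -> E y.

Lemma determined_cylinder x n : determined n (cylinder x n).
Proof. by move=> y z yz xy; exact: cylinder_trans yz. Qed.

Lemma determined_le m n E : (m <= n)%N -> determined m E -> determined n E.
Proof. by move=> mn mE x y /(cylinder_le mn); exact: mE. Qed.

Lemma determinedC n E : determined n E -> determined n (~` E).
Proof. by move=> nE x y /cylinder_sym /nE yx Ex /yx. Qed.

Lemma determinedI n E F : determined n E -> determined n F ->
  determined n (E `&` F).
Proof. by move=> nE nF x y xy [/(nE _ _ xy) ? /(nF _ _ xy)]. Qed.

Lemma determinedU n E F : determined n E -> determined n F ->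
  determined n (E `|` F).
Proof.
by move=> nE nF x y xy [/(nE _ _ xy) ?|/(nF _ _ xy) ?]; [left|right].
Qed.

Lemma open_edge n (e : edges B n) : open [set x : path_space B | edge x n = e].
Proof.
pose p : prod_topology (fun n => discrete_topology (edges B n)) ->
  discrete_topology (edges B n) := proj n.
have -> : [set x : path_space B | edge x n = e] =
    (@path_to_prod B) @^-1` (p @^-1` [set e]) by [].
apply: open_comp; first by move=> ? _; exact: initial_continuous.
apply: open_comp; first by move=> ? _; exact: proj_continuous.
exact: discrete_open.
Qed.

Lemma open_cylinder x n : open (cylinder x n).
Proof.
elim: n => [|n IH]; first by rewrite cylinder0; exact: openT.
have -> : cylinder x n.+1 =
    cylinder x n `&` [set y | edge y n = edge x n].
  apply/seteqP; split=> y.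
    by move=> xy; split; [move=> i lt_in; apply: xy; exact: ltnW|exact: xy].
  by move=> [xy ny] i; rewrite ltnS leq_eqVlt => /orP[/eqP->|/xy].
by apply: openI => //; exact: open_edge.
Qed.

Lemma determined_open n E : determined n E -> open E.
Proof.
move=> nE; have -> : E = \bigcup_(x in E) cylinder x n.
  by apply/seteqP; split=> [x Ex|y [x Ex /nE]]; [exists x|exact].
by apply: bigcup_open => x _; exact: open_cylinder.
Qed.

(** The sets that contain a cylinder around [x] form a filter, which converges
    to [x] coordinatewise, hence in the topology induced by the product. *)
Lemma nbhs_cylinder x (O : set (path_space B)) : nbhs x O ->
  exists n, cylinder x n `<=` O.
Proof.
pose F : set_system (path_space B) := [set A | exists n, cylinder x n `<=` A].
have FF : Filter F.
  split; first by exists 0%N.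
  - move=> P Q [m mP] [n nQ]; exists (maxn m n) => y xy; split.
      by apply: mP; apply: cylinder_le xy; exact: leq_maxl.
    by apply: nQ; apply: cylinder_le xy; exact: leq_maxr.
  - by move=> P Q PQ [n nP]; exists n => y /nP /PQ.
suff : nbhs x `<=` F by move=> H /H.
have FFx : Filter (@path_to_prod B @ F) by exact: fmap_filter.
have H : @path_to_prod B @ F --> path_to_prod x.
  apply/cvg_sup => n A; rewrite nbhsE => -[_ [[C Cop <-] Cx] CA].
  exists n.+1 => y xy; apply: CA; rewrite /= /proj /path_to_prod.
  by rewrite (xy n).
move=> A; rewrite nbhsE => -[_ [[C Cop <-] Cx] CA].
have [n nC] : (@path_to_prod B @ F) C.
  by apply: H; rewrite nbhsE; exists C.
by exists n => y /nC; exact: CA.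
Qed.

End Paths.

(** * Borel sets and finite measures *)

Section Borel.
Variables (R : realType) (B : bratteli).
Implicit Types (x y z : path_space B) (n : nat) (E : set (path_borel B)).

Lemma determined_measurable n E : determined n E -> measurable E.
Proof. by move=> /determined_open oE; apply: sub_sigma_algebra. Qed.

Lemma cylinder_measurable x n : measurable (cylinder x n : set (path_borel B)).
Proof. by apply: (@determined_measurable n); exact: determined_cylinder. Qed.

(** Each set of the union is the largest subset of [O] determined at level [n];
    in this form an open set is visibly a countable union of determined sets. *)
Lemma open_bigcup_determined (O : set (path_space B)) : open O ->
  O = \bigcup_n [set x | cylinder x n `<=` O].
Proof.
move=> oO; apply/seteqP; split=> [x Ox|x [n _]]; last exact.
by have [n nO] := nbhs_cylinder (open_nbhs_nbhs (conj oO Ox)); exists n.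
Qed.

(** Determined sets are open, and open sets are countable unions of determined
    sets. *)
Lemma borel_determined :
  @measurable _ (path_borel B) = <<s [set E | exists n, determined n E] >>.
Proof.
apply/seteqP; split; apply: smallest_sub; try exact: smallest_sigma_algebra.
  move=> O oO; rewrite (open_bigcup_determined oO).
  apply: sigma_algebra_bigcup => n; apply: sub_sigma_algebra; exists n.
  by move=> x y xy xO z yz; apply: xO; exact: cylinder_trans yz.
by move=> E [n nE]; exact: (determined_measurable nE).
Qed.

Lemma determined_setI_closed :
  setI_closed [set E : set (path_borel B) | exists n, determined n E].
Proof.
move=> E F [m mE] [n nF]; exists (maxn m n); apply: determinedI.
  exact: determined_le (leq_maxl _ _) mE.
exact: determined_le (leq_maxr _ _) nF.
Qed.

Definition step n (phi : path_space B -> R) x : R :=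
  \sum_(e : edges B n | src e == path_vertex x n) phi (ext x e).

(** Sum of [phi] over one path from each cylinder of length [n], written as an
    iterated sum over edges: descending the tree of finite paths one edge at a
    time avoids handling the finite paths themselves. *)
Fixpoint tree_sum n (phi : path_space B -> R) : R :=
  if n is m.+1 then tree_sum m (step m phi) else phi point.

(** A quantity that is additive along the tree has the same total on all
    levels. *)
Lemma tree_sum_step (g : nat -> path_space B -> R) :
  (forall n x, g n x = step n (g n.+1) x) ->
  forall n, tree_sum n (g n) = g 0%N point.
Proof.
move=> gS; elim=> [//|n IH] /=; rewrite -IH; congr tree_sum.
by apply/funext => x; rewrite gS.
Qed.

Lemma tree_sum0 n : tree_sum n (fun=> 0) = 0.
Proof.
elim: n => //= n IH; rewrite -[RHS]IH; congr tree_sum.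
by apply/funext => x; rewrite /step big1.
Qed.

Section Measure.
Variable m : {finite_measure set (path_borel B) -> \bar R}.

Definition mass E : R := fine (m E).

Lemma massE E : measurable E -> m E = (mass E)%:E.
Proof. by move=> mE; rewrite /mass fineK // fin_num_measure. Qed.

Lemma mass_ge0 E : 0 <= mass E.
Proof. by rewrite /mass fine_ge0. Qed.

Lemma mass_step E x n : measurable E ->
  mass (E `&` cylinder x n) =
  step n (fun y => mass (E `&` cylinder y n.+1)) x.
Proof.
move=> mE; pose F (e : edges B n) : set (path_borel B) :=
  E `&` cylinder x n `&` [set y | edge y n = e].
have mF e : measurable (F e).
  apply: measurableI; last by apply: sub_sigma_algebra; exact: open_edge.
  by apply: measurableI => //; exact: cylinder_measurable.
have EF : E `&` cylinder x n = \bigcup_e F e.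
  by apply/seteqP; split=> [y Ey|y [e _ []]//]; exists (edge y n).
rewrite /mass EF measure_fin_bigcup //; first last.
  by move=> e e' _ _ [y [[_ <-] [_ <-]]].
  exact: finite_finset.
have -> : [set: edges B n] = [set` index_enum (edges B n)].
  by apply/seteqP; split=> e // _; exact: mem_index_enum.
rewrite -fsbig_seq ?index_enum_uniq // -sum_fine; last first.
  by move=> e _; rewrite fin_num_measure.
rewrite /step [RHS]big_mkcond /=; apply: eq_bigr => e _; case: eqP => [se|se].
  congr (fine (m _)); apply/seteqP; split=> y.
    by move=> [[Ey xy] ye]; split=> //; apply/cylinder_extE.
  by move=> [Ey /(cylinder_extE _ se)[]].
rewrite (_ : F e = set0) ?measure0 //.
apply/seteqP; split=> y // [[_ xy] ye]; apply: se.
by rewrite -ye src_edge; exact: cylinder_vertex.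
Qed.

End Measure.

Lemma mass_eq (m m' : {finite_measure set (path_borel B) -> \bar R}) E :
  measurable E -> mass m E = mass m' E -> m E = m' E.
Proof. by move=> mE EE; rewrite !massE // EE. Qed.

(** A set determined at level [n] is a finite disjoint union of cylinders of
    length [n]; from these sets, which are stable under intersection, the
    relation passes to the Borel sets by Dynkin's theorem. *)
Lemma mass_combination_eq0 (I : finType)
    (m : I -> {finite_measure set (path_borel B) -> \bar R}) (c : I -> R) N :
  (forall n x, (N <= n)%N -> \sum_i c i * mass (m i) (cylinder x n) = 0) ->
  forall E, measurable E -> \sum_i c i * mass (m i) E = 0.
Proof.
move=> c0.
have Hdet n E : determined n E -> \sum_i c i * mass (m i) E = 0.
  move=> nE0; wlog nN : n nE0 / (N <= n)%N.
    apply; last exact: (leq_maxl N n).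
    exact: determined_le (leq_maxr _ _) nE0.
  pose g j x := \sum_i c i * mass (m i) (E `&` cylinder x j).
  have mE := determined_measurable nE0.
  have gS j x : g j x = step j (g j.+1) x.
    rewrite /step /g exchange_big; apply: eq_bigr => i _ /=.
    by rewrite -mulr_sumr mass_step.
  have := tree_sum_step gS n; rewrite /g cylinder0 setIT => <-.
  rewrite -[RHS](tree_sum0 n); congr tree_sum; apply/funext => x.
  have [Ex|Ex] := pselect (E x).
    rewrite (_ : E `&` _ = cylinder x n) ?c0 //.
    by apply/seteqP; split=> [y []|y xy] //; split=> //; exact: nE0 xy Ex.
  rewrite (_ : E `&` _ = set0) ?big1 // => [i _|].
    by rewrite /mass measure0 mulr0.
  apply/seteqP; split=> y // [Ey xy]; apply: Ex.
  by apply: nE0 Ey; exact: cylinder_sym.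
move=> E mE.
apply: (@dynkin_induction _ (path_borel B) _
  [set E | \sum_i c i * mass (m i) E = 0] borel_determined).
- exact: determined_setI_closed.
- by apply: (Hdet 0%N).
- by move=> F [n]; exact: Hdet.
- move=> F mF /= F0; have := Hdet 0%N setT (fun _ _ _ _ => Logic.I).
  rewrite -[X in _ = X]F0 => /esym E0.
  suff : \sum_i c i * mass (m i) (~` F) + \sum_i c i * mass (m i) F = 
     \sum_i c i * mass (m i) setT by rewrite E0 -[RHS]add0r => /addIr.
  rewrite -big_split /=; apply: eq_bigr => i _; rewrite -mulrDr; congr (_ * _).
  rewrite /mass -fineD ?fin_num_measure //; last exact: measurableC.
  rewrite -measureU //; last by rewrite setICl.
    by rewrite setUC setUv.
  exact: measurableC.
- move=> F mF tF F0 /=.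
  have mU : measurable (\bigcup_k F k) by exact: bigcupT_measurable.
  have cv i : (fun n => \sum_(0 <= j < n) mass (m i) (F j)) @ \oo -->
      mass (m i) (\bigcup_k F k).
    have : (fun n => \sum_(0 <= j < n) m i (F j))%E @ \oo -->
        (mass (m i) (\bigcup_k F k))%:E.
      rewrite -massE //; exact: measure_semi_sigma_additive.
    move=> /fine_cvg; apply: cvg_trans; apply: near_eq_cvg.
    apply: nearW => n; rewrite /= sum_fine // => j _.
    by rewrite fin_num_measure.
  have : (fun n => \sum_i c i * \sum_(0 <= j < n) mass (m i) (F j)) @ \oo -->
      \sum_i c i * mass (m i) (\bigcup_k F k).
    apply: cvg_big => [|i _]; first exact: add_continuous.
    by apply: cvgMr; exact: cv.
  rewrite (_ : (fun n => _) = cst 0).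
    by move/cvg_lim => <- //; rewrite lim_cst.
  apply/funext => n; under eq_bigr do rewrite mulr_sumr.
  by rewrite exchange_big big1 // => j _; exact: F0.
- by rewrite -borel_determined.
Qed.

End Borel.

(** * The measure defined by consistent vertex weights *)

(** The same paths, with the algebra of sets determined by finitely many edges
    in place of the Borel sets: the domain of the set function to extend. *)
Definition path_algebra (B : bratteli) := path_space B.

Section PathAlgebra.
Variable B : bratteli.

Let determined_set : set (set (path_space B)) :=
  [set E | exists n, determined n E].

Let determined_set0 : determined_set set0. Proof. by exists 0%N. Qed.

Let determined_setU : setU_closed determined_set.
Proof.
move=> E F [m mE] [n nF]; exists (maxn m n); apply: determinedU.
  exact: determined_le (leq_maxl _ _) mE.
exact: determined_le (leq_maxr _ _) nF.
Qed.

Let determined_setC : setC_closed determined_set.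
Proof. by move=> E [n nE]; exists n; exact: determinedC. Qed.

HB.instance Definition _ := Pointed.copy (path_algebra B) (path_space B).
HB.instance Definition _ :=
  @isAlgebraOfSets.Build default_measure_display (path_algebra B)
    determined_set determined_set0 determined_setU determined_setC.

End PathAlgebra.

Section TreeSum.
Variables (R : realType) (B : bratteli).
Implicit Types (phi psi : path_space B -> R).

Lemma tree_sumD n phi psi :
  tree_sum n (fun x => phi x + psi x) = tree_sum n phi + tree_sum n psi.
Proof.
elim: n phi psi => //= n IH phi psi; rewrite -IH; congr tree_sum.
by apply/funext => x; rewrite /step big_split.
Qed.

Lemma tree_sum_ge0 n phi : (forall x, 0 <= phi x) -> 0 <= tree_sum n phi.
Proof.
elim: n phi => //= n IH phi phi0; apply: IH => x.
by apply: sumr_ge0 => e _.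
Qed.

Lemma tree_sum_cylinder n x (c : R) :
  tree_sum n (fun y : path_space B => c * (y \in cylinder x n)%:R) = c.
Proof.
elim: n => [|n IH] /=; first by rewrite cylinder0 in_setT mulr1.
rewrite -[RHS]IH; congr tree_sum; apply/funext => y; rewrite /step.
have [xy|xy] := pselect (cylinder x n y).
  rewrite [in RHS]mem_set // (bigD1 (edge x n)) /=; last first.
    by rewrite src_edge (cylinder_vertex xy).
  have se : src (edge x n) = path_vertex y n.
    by rewrite src_edge (cylinder_vertex xy).
  rewrite mem_set; last first.
    have [e1 e2] := extP se.
    move=> i; rewrite ltnS leq_eqVlt => /orP[/eqP->|lt_in] //.
    by rewrite e1 // xy.
  rewrite big1 ?addr0 // => e /andP[/eqP ev ee].
  rewrite memNset ?mulr0 // => /(_ n (ltnSn n)).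
  by have [_ ->] := extP ev => E; rewrite E eqxx in ee.
rewrite [in RHS]memNset // mulr0 big1 // => e /eqP ev.
rewrite memNset ?mulr0 // => H; apply: xy => i lt_in.
by have [e1 _] := extP ev; rewrite -e1 // H // ltnW.
Qed.

End TreeSum.

Section WeightedMeasure.
Variables (R : realType) (B : bratteli).
Hypothesis path_compact : compact [set: path_space B].
Variable p : forall n, level B n -> R.
Arguments p {n}.
(* [p v] is to be the mass of each cylinder that ends at [v]. *)
Hypothesis p_ge0 : forall n (v : level B n), 0 <= p v.
Hypothesis p0 : forall v : level B 0, p v = 1.
Hypothesis pS : forall n (w : level B n),
  p w = \sum_(e : edges B n | src e == w) p (rng e).
Implicit Types (E F : set (path_space B)).

Definition level_content n E : R :=
  tree_sum n (fun x => p (path_vertex x n) * (x \in E)%:R).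

(** Consistency of the weights: splitting the cylinders of length [n] by their
    next edge does not change the total. *)
Lemma level_content_stable m n E : determined m E -> (m <= n)%N ->
  level_content n E = level_content m E.
Proof.
move=> mE; elim: n => [|n IH]; first by rewrite leqn0 => /eqP->.
rewrite leq_eqVlt => /orP[/eqP->//|mn]; rewrite -IH // /level_content /=.
congr tree_sum; apply/funext => x; rewrite /step pS mulr_suml.
apply: eq_bigr => e /eqP ev; rewrite -[rng (edge _ _)]/(path_vertex _ n.+1).
rewrite path_vertex_ext //; congr (_ * (_ : bool)%:R).
have H := cylinder_le (mn : (m <= n)%N) (cylinder_ext ev).
apply/idP/idP; rewrite !inE; apply: mE => //.
exact: cylinder_sym.
Qed.

Definition weight_content (E : set (path_algebra B)) : \bar R :=
  if pselect (exists n, determined n E) is left H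
  then (level_content (sval (cid H)) E)%:E else 0%E.

Lemma contentE n E : determined n E ->
  weight_content E = (level_content n E)%:E.
Proof.
move=> nE; rewrite /weight_content; case: pselect => [H|[]]; last by exists n.
case: (cid H) => m mE /=; congr _%:E.
by case: (leqP m n) => [|/ltnW] mn; [rewrite (@level_content_stable m n)|
  rewrite (@level_content_stable n m)].
Qed.

Lemma level_content_setU n E F : [disjoint E & F] ->
  level_content n (E `|` F) = level_content n E + level_content n F.
Proof.
move=> EF; rewrite -tree_sumD; congr tree_sum; apply/funext => x.
rewrite -mulrDr in_setU; congr (_ * _).
have [Ex|] := boolP (x \in E); have [Fx|] := boolP (x \in F);
  rewrite ?addr0 ?add0r //.
move/disj_set2P: EF => /seteqP[/(_ x) EF _].
by rewrite !inE in Ex Fx; have := EF (conj Ex Fx).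
Qed.

Let content0 : weight_content set0 = 0%E.
Proof.
rewrite (@contentE 0%N) // /level_content /=; congr _%:E.
by rewrite in_set0 mulr0.
Qed.

Let content_ge0 E : (0 <= weight_content E)%E.
Proof.
rewrite /weight_content; case: pselect => // H; rewrite lee_fin.
by apply: tree_sum_ge0 => x; rewrite mulr_ge0.
Qed.

Let content_sum (F : nat -> set (path_algebra B)) N :
  (forall i, measurable (F i)) -> trivIset setT F ->
  weight_content (\big[setU/set0]_(i < N) F i) =
    (\sum_(0 <= i < N) weight_content (F i))%E.
Proof.
move=> mF tF; elim: N => [|N IH]; first by rewrite big_ord0 big_nil.
rewrite big_ord_recr big_nat_recr //= -IH.
have [n nU] : measurable (\big[setU/set0]_(i < N) F i).
  exact: bigsetU_measurable.
have [m mFN] := mF N.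
have nU' := determined_le (leq_maxl n m) nU.
have nF' := determined_le (leq_maxr n m) mFN.
rewrite (contentE (determinedU nU' nF')) (contentE nU') (contentE nF').
rewrite -EFinD level_content_setU //.
apply/disj_set2P; rewrite -bigcup_mkord; apply/seteqP; split=> // x [].
move=> [i /= iN Fix] FNx; move: (iN); rewrite (tF i N) ?ltnn //.
by exists x.
Qed.

(** Compactness makes countable additivity automatic on the algebra: a set of
    the algebra covered by countably many others is covered by finitely many. *)
Let content_sigma_additive :
  semi_sigma_additive (weight_content : set (path_algebra B) -> \bar R).
Proof.
move=> F mF tF [n nU].
have [N HN] : exists N, \bigcup_k F k = \big[setU/set0]_(i < N) F i.
  have cU : compact (\bigcup_k F k : set (path_space B)).
    apply: subclosed_compact path_compact _ => //.
    by rewrite -[X in closed X]setCK; apply/open_closedC/determined_open;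
      exact: determinedC nU.
  move: cU; rewrite compact_cover => /(_ _ setT F).
  case=> [i _|//|D _ UD]; first by have [m /determined_open] := mF i.
  exists (\max_(i <- finmap.enum_fset D) i).+1.
  apply/seteqP; split=> [x /UD [i /= iD Fx]|x]; last first.
    by rewrite -bigcup_mkord => -[i _ Fx]; exists i.
  rewrite -bigcup_mkord; exists i => //=; rewrite ltnS.
  by apply: leq_bigmax_seq.
apply: cvg_near_cst; exists N => // j /= Nj.
rewrite -content_sum //; congr weight_content; rewrite HN.
rewrite -[RHS]HN; apply/seteqP; split=> x; rewrite -bigcup_mkord.
  by move=> [i _ Fx]; exists i.
rewrite HN -bigcup_mkord => -[i /= iN Fx]; exists i => //=.
exact: leq_trans Nj.
Qed.

HB.instance Definition _ := isMeasure.Build _ (path_algebra B) R weight_content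
  content0 content_ge0 content_sigma_additive.

(** The Borel sets are the sigma-algebra generated by the algebra, but not by
    definition: the extension is copied from one type to the other. *)
Definition weight_extension : set (path_borel B) -> \bar R :=
  measure_extension weight_content.

Let measurableE (E : set (path_borel B)) : measurable E ->
  measurable (E : set (g_sigma_algebraType (@measurable _ (path_algebra B)))).
Proof.
rewrite [X in X -> _](_ : _ = <<s [set E | exists n, determined n E] >> E) //.
by rewrite -borel_determined.
Qed.

Let extension0 : weight_extension set0 = 0%E. Proof. exact: measure0. Qed.

Let extension_ge0 E : (0 <= weight_extension E)%E.
Proof. exact: measure_ge0. Qed.

Let extension_sigma_additive : semi_sigma_additive weight_extension.
Proof.
move=> F mF tF mU; apply: measure_semi_sigma_additive => //.
  by move=> i; exact: measurableE.
exact: measurableE.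
Qed.

HB.instance Definition _ := isMeasure.Build _ (path_borel B) R weight_extension
  extension0 extension_ge0 extension_sigma_additive.

Let extension_determined n E : determined n E ->
  weight_extension E = (level_content n E)%:E.
Proof.
move=> nE; rewrite -(contentE nE) /weight_extension /measure_extension.
by rewrite measurable_mu_extE //; exists n.
Qed.

Let extension_cylinder x n :
  weight_extension (cylinder x n) = (p (path_vertex x n))%:E.
Proof.
rewrite (extension_determined (@determined_cylinder _ x n)); congr _%:E.
rewrite -[RHS](tree_sum_cylinder n x); congr tree_sum; apply/funext => y.
have [xy|xy] := pselect (cylinder x n y).
  by rewrite (cylinder_vertex xy).
by rewrite memNset // !mulr0.
Qed.

Let extensionT : weight_extension setT = 1%E.
Proof. by rewrite -(cylinder0 point) extension_cylinder p0. Qed.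

HB.instance Definition _ :=
  Measure_isProbability.Build _ (path_borel B) R weight_extension extensionT.

(** The extension of [weight_content] from the algebra to the Borel sets. *)
Lemma weights_probability : exists mu : probability (path_borel B) R,
  forall x n, mu (cylinder x n) = (p (path_vertex x n))%:E.
Proof. by exists weight_extension; exact: extension_cylinder. Qed.

End WeightedMeasure.

(** * Invariant measures and the separation of ergodic ones *)

Section Transport.
Variables (R : realType) (B : bratteli).
Variable m : {finite_measure set (path_borel B) -> \bar R}.
Variables (D : set (path_borel B)) (f : path_borel B -> path_borel B).
Hypothesis mD : measurable D.
Hypothesis mf : measurable_fun [set: path_borel B] f.

(** The image under [f] of the restriction of [m] to [D]: for [f] the identity
    this is a restriction, for [f] an exchange of initial segments and [D] a
    cylinder the other side of [invariant_splice]. *)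
Definition transport (E : set (path_borel B)) : \bar R := m (D `&` f @^-1` E).

Let preimage_measurable E : measurable E -> measurable (f @^-1` E).
Proof. by move=> mE; rewrite -[X in measurable X]setTI; exact: mf. Qed.

Let transport0 : transport set0 = 0%E.
Proof. by rewrite /transport preimage_set0 setI0 measure0. Qed.

Let transport_ge0 E : (0 <= transport E)%E. Proof. exact: measure_ge0. Qed.

Let transport_sigma_additive : semi_sigma_additive transport.
Proof.
move=> F mF tF mU; rewrite /transport preimage_bigcup setI_bigcupr.
apply: measure_semi_sigma_additive.
- by move=> i; apply: measurableI => //; exact: preimage_measurable.
- move=> i j _ _ [z [[_ Fi] [_ Fj]]]; apply: (tF i j) => //.
  by exists (f z).
- by apply: bigcupT_measurable => i; apply: measurableI => //;
    exact: preimage_measurable.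
Qed.

HB.instance Definition _ := isMeasure.Build _ (path_borel B) R transport
  transport0 transport_ge0 transport_sigma_additive.

Let transport_fin : fin_num_fun transport.
Proof.
move=> E mE; apply: fin_num_measure; apply: measurableI => //.
exact: preimage_measurable.
Qed.

HB.instance Definition _ :=
  Measure_isFinite.Build _ (path_borel B) R transport transport_fin.

Lemma transport_measure :
  exists m' : {finite_measure set (path_borel B) -> \bar R},
  forall E, m' E = m (D `&` f @^-1` E).
Proof. by exists transport. Qed.

End Transport.

Section Invariance.
Variables (R : realType) (B : bratteli).
Implicit Types (x y z w : path_space B) (n : nat) (E : set (path_borel B)).
Implicit Types m : {finite_measure set (path_borel B) -> \bar R}.

(** [invariant_measure] without the normalization, so that it applies to
    restrictions. *)
Definition invariant m := forall n x y, path_vertex x n = path_vertex y n ->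
  m (cylinder x n) = m (cylinder y n).

Lemma probability_mass (mu : probability (path_borel B) R) E (a : R) :
  mu E = a%:E -> mass mu E = a.
Proof. by move=> muE; rewrite /mass -[RHS]/(fine a%:E) -muE. Qed.

Lemma mass_setT (mu : probability (path_borel B) R) : mass mu setT = 1.
Proof. exact/probability_mass/probability_setT. Qed.

Lemma mass_unique m m' N :
  (forall n x, (N <= n)%N ->
    mass m (cylinder x n) = mass m' (cylinder x n)) ->
  forall E, measurable E -> m E = m' E.
Proof.
move=> mm' E mE; apply/mass_eq => //.
have /(_ _ E mE) := @mass_combination_eq0 R B bool
  (fun b => if b then m else m') (fun b => if b then 1 else -1) N.
rewrite big_bool /= mul1r mulN1r => H; apply/eqP; rewrite -subr_eq0; apply/eqP.
by apply: H => n x /mm' E'; rewrite big_bool /= E' mul1r mulN1r subrr.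
Qed.

Lemma splice_measurable x n :
  measurable_fun [set: path_borel B]
    (splice x n : path_borel B -> path_borel B).
Proof.
apply: (measurability _ (borel_determined B)) => _ [E [m mE] <-].
rewrite setTI; apply: (@determined_measurable _ (maxn m n)) => z z' zz'.
have vz : path_vertex z' n = path_vertex z n.
  by apply: cylinder_vertex; apply: cylinder_le zz'; exact: leq_maxr.
have zm : cylinder z m z' by apply: cylinder_le zz'; exact: leq_maxl.
rewrite /preimage /=.
have [xz|xz] := pselect (path_vertex x n = path_vertex z n).
  apply: mE => i lt_im; rewrite !edge_splice ?vz //.
  by case: ifP => // _; exact: zm.
by rewrite !splice_id ?vz //; exact: mE.
Qed.

Lemma path_vertex_splice x n z : path_vertex x n = path_vertex z n ->
  forall j, (n <= j)%N -> path_vertex (splice x n z) j = path_vertex z j.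
Proof.
move=> xz j; rewrite leq_eqVlt => /orP[/eqP<-|].
  by rewrite -xz; apply: cylinder_vertex; exact: cylinder_splice.
by case: j => // j lt_nj /=; rewrite edge_splice // ltnNge -ltnS lt_nj.
Qed.

Lemma spliceK x y n z : cylinder x n z ->
  path_vertex x n = path_vertex y n -> splice x n (splice y n z) = z.
Proof.
move=> xz xy; have yz : path_vertex y n = path_vertex z n.
  by rewrite -xy (cylinder_vertex xz).
apply: path_eqP => i; rewrite edge_splice; last first.
  by rewrite path_vertex_splice // (cylinder_vertex xz).
by rewrite edge_splice //; case: ltnP => // lt_in; rewrite xz.
Qed.

(** Exchanging two initial segments that end at the same vertex preserves an
    invariant measure: it maps cylinders to cylinders of the same measure. *)
Lemma invariant_splice m n x y E : invariant m ->
  path_vertex x n = path_vertex y n -> measurable E ->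
  m (cylinder y n `&` splice x n @^-1` E) = m (cylinder x n `&` E).
Proof.
move=> im xy mE.
have [m1 m1E] :=
  transport_measure m (@cylinder_measurable _ y n) (@splice_measurable x n).
have [m2 m2E] := transport_measure m (@cylinder_measurable _ x n)
  (@measurable_id _ (path_borel B) setT).
rewrite -m1E -[RHS]m2E; apply: (@mass_unique _ _ n) => // j w nj.
rewrite /mass m1E m2E preimage_id; congr fine.
have [xw|xw] := pselect (cylinder x n w).
  have yw : path_vertex y n = path_vertex w n.
    by rewrite -xy (cylinder_vertex xw).
  have xv : path_vertex x n = path_vertex w n by rewrite xy.
  have -> : cylinder x n `&` cylinder w j = cylinder w j.
    apply/seteqP; split=> [z []//|z wz]; split=> //.
    exact/(cylinder_trans xw)/(cylinder_le nj).
  have -> : cylinder y n `&` splice x n @^-1` cylinder w j =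
      cylinder (splice y n w) j.
    apply/seteqP; split=> z.
      move=> [yz wz] i ij; rewrite edge_splice //; case: ifP => [lt_in|ni].
        exact: yz.
      have := wz i ij; rewrite edge_splice ?ni //.
      by rewrite xy (cylinder_vertex yz).
    move=> H; have yz : cylinder y n z.
      move=> i lt_in; rewrite H ?(leq_trans lt_in) // edge_splice //.
      by rewrite lt_in.
    split=> // i ij; rewrite /= edge_splice; last first.
      by rewrite xy (cylinder_vertex yz).
    case: ifP => [lt_in|ni]; first by rewrite xw.
    by rewrite H // edge_splice // ni.
  by apply: im; exact: path_vertex_splice.
have -> : cylinder x n `&` cylinder w j = set0.
  apply/seteqP; split=> // z [xz wz]; apply: xw; apply: cylinder_trans xz _.
  exact/cylinder_sym/(cylinder_le nj).
rewrite (_ : _ `&` _ = set0) //; apply/seteqP; split=> // z [yz wz]; apply: xw.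
apply: (@cylinder_trans _ _ (splice x n z)).
  by apply: cylinder_splice; rewrite xy (cylinder_vertex yz).
exact/cylinder_sym/(cylinder_le nj).
Qed.

(** The exchanges of initial segments map a tail invariant set to itself. *)
Lemma invariant_restriction m m' (D : set (path_borel B)) :
  invariant m -> measurable D -> tail_invariant_set D ->
  (forall E, m' E = m (D `&` E)) -> invariant m'.
Proof.
move=> im mD tD m'E n x y xy; rewrite !m'E ![D `&` _]setIC.
rewrite -(invariant_splice im xy mD); congr (m _).
apply/seteqP; split=> z [yz Dz]; split=> //; move: Dz => /=.
  apply: tD; exists n => i ni; rewrite edge_splice ?ltnNge ?ni //.
  by rewrite xy (cylinder_vertex yz).
apply: tD; exists n => i ni; rewrite edge_splice ?ltnNge ?ni //.
by rewrite xy (cylinder_vertex yz).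
Qed.

(** Finitely many paths that meet every cylinder of length [n]. *)
Fixpoint cylinder_reps n : seq (path_space B) :=
  if n is m.+1 then
    [seq ext x e | x <- cylinder_reps m, e <- enum (edges B m)]
  else [:: point].

Lemma cylinder_repsP n y :
  exists i, cylinder (nth point (cylinder_reps n) i) n y.
Proof.
suff [x xr xy] : exists2 x, x \in cylinder_reps n & cylinder x n y.
  by exists (index x (cylinder_reps n)); rewrite nth_index.
elim: n => [|n [x xr xy]] /=; first by exists point; rewrite ?inE ?cylinder0.
have se : src (edge y n) = path_vertex x n.
  by rewrite src_edge (cylinder_vertex xy).
exists (ext x (edge y n)); last exact/cylinder_extE.
by apply: allpairs_f => //; rewrite mem_enum.
Qed.

Definition tail_saturation (A : set (path_space B)) : set (path_space B) :=
  [set z | exists2 w, A w & tail_equiv w z].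

Lemma tail_saturation_invariant A : tail_invariant_set (tail_saturation A).
Proof.
move=> x y [N xy] [w Aw [M wx]]; exists w => //; exists (maxn N M) => n.
by rewrite geq_max => /andP[Nn Mn]; rewrite wx // xy.
Qed.

Lemma tail_invariantC (A : set (path_space B)) :
  tail_invariant_set A -> tail_invariant_set (~` A).
Proof.
move=> tA x y [N xy] Ax Ay; apply: Ax; apply: tA Ay.
by exists N => n /xy.
Qed.

Definition swap_image (A : set (path_space B)) n x y : set (path_space B) :=
  if pselect (path_vertex x n = path_vertex y n) is left _
  then cylinder y n `&` splice x n @^-1` A else set0.

Let saturation_piece (A : set (path_space B)) (k : nat) : set (path_space B) :=
  if (unpickle k : option (nat * nat * nat)) is Some (n, i, j) then
    swap_image A n (nth point (cylinder_reps n) i)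
      (nth point (cylinder_reps n) j)
  else set0.

(** A path that agrees with [w] from level [n] on arises from [w] by an exchange
    of initial segments of length [n]; such exchanges are countably many. *)
Lemma tail_saturationE A : tail_saturation A = \bigcup_k saturation_piece A k.
Proof.
apply/seteqP; split=> [z [w Aw [n wz]]|z [k _]].
  have [i iw] := cylinder_repsP n w; have [j jz] := cylinder_repsP n z.
  exists (pickle (n, i, j)) => //; rewrite /saturation_piece pickleK.
  have wzn : path_vertex w n = path_vertex z n.
    by rewrite -!src_edge wz.
  have iz : path_vertex (nth point (cylinder_reps n) i) n = path_vertex z n.
    by rewrite -wzn (cylinder_vertex iw).
  rewrite /swap_image; case: pselect => [_|[]]; last first.
    by rewrite iz (cylinder_vertex jz).
  split=> //=; rewrite (_ : splice _ _ _ = w) //.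
  apply: path_eqP => l; rewrite edge_splice //; case: (ltnP l n) => [lt_ln|nl].
    by rewrite iw.
  by rewrite wz.
rewrite /saturation_piece; case: unpickle => // -[[n i] j].
rewrite /swap_image; case: pselect => // ij [jz Az].
exists (splice (nth point (cylinder_reps n) i) n z) => //.
exists n => l nl; rewrite edge_splice ?ltnNge ?nl //.
by rewrite ij (cylinder_vertex jz).
Qed.

(** Let [N] be the negative part of a Hahn decomposition of [nu - nu'].  The
    exchanges of initial segments preserve both measures, hence carry negative
    sets to negative sets; so the tail saturation [D] of [N] is negative, and
    its complement is positive.  Each measure gives [D] the mass [0] or [1].  If
    both values are [0], then [nu' <= nu] everywhere, if both are [1], then
    [nu <= nu'], and between probabilities either inequality is an equality;
    and negativity of [D] excludes that only [nu D] be [1]. *)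
Lemma ergodic_separated (nu nu' : probability (path_borel B) R) :
  invariant_measure nu -> invariant_measure nu' ->
  ergodic_measure nu -> ergodic_measure nu' -> ~ same_measure nu nu' ->
  exists D : set (path_borel B),
    [/\ measurable D, tail_invariant_set D, nu D = 0%E & nu' D = 1%E].
Proof.
move=> inu inu' enu enu' dnu.
pose sigma := cadd (charge_of_finite_measure nu)
  (cscale (-1) (charge_of_finite_measure nu')).
have sigmaE E : measurable E -> sigma E = (mass nu E - mass nu' E)%:E.
  move=> mE; rewrite EFinB -(massE nu mE) -(massE nu' mE).
  by rewrite /sigma /cadd /= /cscale EFinN mulN1e.
have [P [N [[mP posP] [mN negN] PN PN0]]] := Hahn_decomposition sigma.
pose D : set (path_borel B) := tail_saturation N.
have negD : negative_set sigma D.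
  rewrite /D tail_saturationE; apply: bigcup_negative_set => k.
  rewrite /saturation_piece; case: unpickle => [[[n i] j]|]; last first.
    exact: negative_set0.
  move: (nth _ _ i) (nth _ _ j) => x y; rewrite /swap_image.
  case: pselect => [xy|_]; last exact: negative_set0.
  have mS :
      measurable (cylinder y n `&` splice x n @^-1` N : set (path_borel B)).
    apply: measurableI; first exact: cylinder_measurable.
    by rewrite -[X in measurable X]setTI; exact: splice_measurable.
  split=> // A mA AS.
  (* [A'] is the image of [A] under the inverse exchange, a subset of [N] *)
  pose A' : set (path_borel B) := cylinder x n `&` splice y n @^-1` A.
  have mA' : measurable A'.
    apply: measurableI; first exact: cylinder_measurable.
    by rewrite -[X in measurable X]setTI; exact: splice_measurable.
  have AE : A = cylinder y n `&` A.
    by apply/seteqP; split=> [z Az|z []//]; split=> //; have [] := AS _ Az.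
  rewrite -[X in (X <= _)%E]/(sigma A).
  have -> : sigma A = sigma A'.
    rewrite !sigmaE // /mass; congr ((fine _ - fine _)%:E).
      by rewrite [in LHS]AE -(invariant_splice inu (esym xy)).
    by rewrite [in LHS]AE -(invariant_splice inu' (esym xy)).
  apply: negN => // w [xw /= yw].
  by have [_ /=] := AS _ yw; rewrite spliceK.
have mD : measurable D by case: negD.
have tD : tail_invariant_set D by exact: tail_saturation_invariant.
have neg E : measurable E -> E `<=` D -> mass nu E <= mass nu' E.
  move=> mE ED; have := negD.2 E mE ED.
  by rewrite -[X in (X <= _)%E -> _]/(sigma E) sigmaE // lee_fin subr_le0.
have pos E : measurable E -> E `<=` ~` D -> mass nu' E <= mass nu E.
  move=> mE ED; have := posP E mE.
  rewrite -[X in (_ -> (_ <= X)%E) -> _]/(sigma E) sigmaE // lee_fin subr_ge0.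
  apply.
  move=> z Ez; have : (P `|` N) z by rewrite PN.
  case=> // Nz; exfalso; apply: (ED _ Ez); exists z => //; by exists 0%N.
have massC (mu : probability (path_borel B) R) E :
    measurable E -> mass mu (~` E) = 1 - mass mu E.
  move=> mE; apply: EFin_inj; rewrite EFinB -!massE //.
    exact: probability_setC.
  exact: measurableC.
have le_same : (forall E, measurable E -> mass nu E <= mass nu' E) ->
    same_measure nu nu'.
  move=> H E mE; apply/mass_eq => //; apply/eqP; rewrite eq_le H //=.
  have := H _ (measurableC mE); rewrite !massC //; lra.
have ge_same : (forall E, measurable E -> mass nu' E <= mass nu E) ->
    same_measure nu nu'.
  move=> H E mE; apply/mass_eq => //; apply/eqP; rewrite eq_le H // andbT.
  have := H _ (measurableC mE); rewrite !massC //; lra.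
have massDI (mu : probability (path_borel B) R) E F :
    measurable E -> measurable F ->
    mass mu E = mass mu (E `&` F) + mass mu (E `&` ~` F).
  move=> mE mF; have mEF := measurableI _ _ mE mF.
  have mEF' := measurableI _ _ mE (measurableC mF).
  apply: EFin_inj; rewrite EFinD -!massE // addeC -setDE.
  exact: measureDI.
have mass_le (mu : probability (path_borel B) R) E F :
    measurable E -> measurable F -> E `<=` F -> mass mu E <= mass mu F.
  move=> mE mF EF; apply: fine_le; rewrite ?fin_num_measure //.
  by apply: le_measure; rewrite ?inE.
case: (enu D mD tD) => [nuD|nuD]; case: (enu' D mD tD) => [nuD'|nuD'];
  move: (probability_mass nuD) (probability_mass nuD') => mnuD mnuD'.
- exfalso; apply/dnu/ge_same => E mE; rewrite (massDI nu' E D) //.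
  have : mass nu' (E `&` D) <= mass nu' D.
    by apply: mass_le => //; exact: measurableI.
  have mED : measurable (E `&` ~` D).
    by apply: measurableI => //; exact: measurableC.
  have := pos _ mED (@subIsetr _ _ _).
  have := mass_le nu _ _ mED mE (@subIsetl _ _ _); lra.
- by exists D.
- have := neg D mD (@subset_refl _ _); lra.
- exfalso; apply/dnu/le_same => E mE; rewrite (massDI nu E D) //.
  have mED : measurable (E `&` ~` D).
    by apply: measurableI => //; exact: measurableC.
  have mED' : measurable (E `&` D) by exact: measurableI.
  have : mass nu (E `&` ~` D) <= mass nu (~` D).
    by apply: mass_le => //; exact: measurableC.
  rewrite massC // => H.
  have := neg _ mED' (@subIsetr _ _ _).
  have := mass_le nu' _ _ mED' mE (@subIsetl _ _ _); lra.
Qed.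

End Invariance.

(** * Limits along an ultrafilter *)

Section UltraLimits.
Variables (R : realType) (U : set_system nat).
Context {UU : UltraFilter U}.
Hypothesis subU : \oo `<=` U.

Let PU : ProperFilter U. Proof. exact: ultra_proper. Qed.

(** Along one fixed ultrafilter all bounded sequences converge at once, which
    replaces the successive extraction of subsequences. *)
Lemma bounded_ultra_cvg (f : nat -> R) (a b : R) :
  (forall n, a <= f n <= b) -> exists l : R, f @ U --> l.
Proof.
move=> fab; have /(_ (f @ U)) := @segment_compact R a b.
case=> [|l [_ cl]].
  change (U (f @^-1` `[a, b]%classic)).
  by apply: filterS filterT => n _ /=; rewrite in_itv /= fab.
exists l => A Al; have [//|UA] := in_ultra_setVsetC (f @^-1` A) UU.
by have [x [/= + ?]] := cl (~` A) A UA Al.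
Qed.

Lemma ultra_cvg_near_eq (f g : nat -> R) (l : R) N :
  (forall n, (N <= n)%N -> f n = g n) -> f @ U --> l -> g @ U --> l.
Proof.
move=> fg; apply: cvg_trans; apply: near_eq_cvg; apply: subU.
by exists N => // n /fg.
Qed.

Lemma ultra_cvg_sum (I : finType) (f : I -> nat -> R) (l : I -> R) :
  (forall i, f i @ U --> l i) ->
  (fun n => \sum_i f i n) @ U --> \sum_i l i.
Proof.
by move=> fl; apply: cvg_big => [|i _]; [exact: add_continuous|exact: fl].
Qed.

Lemma ultra_cvg_det k (A : nat -> 'M[R]_k) (L : 'M[R]_k) :
  (forall i j, (fun n => A n i j) @ U --> L i j) ->
  (fun n => \det (A n)) @ U --> \det L.
Proof.
move=> AL; apply: ultra_cvg_sum => s; apply: cvgMr.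
by apply: cvg_big => [|i _]; [exact: mul_continuous|exact: AL].
Qed.

Lemma ultra_cvg_ge (f : nat -> R) (l c : R) N :
  (forall n, (N <= n)%N -> c <= f n) -> f @ U --> l -> c <= l.
Proof.
move=> cf fl; rewrite -(cvg_lim _ fl) //; apply: limr_ge.
  by apply/cvg_ex; exists l.
by apply: subU; exists N.
Qed.

Lemma ultra_cvg_stochastic k (A : nat -> 'M[R]_k) (L : 'M[R]_k) N :
  (forall n, (N <= n)%N -> stochastic (A n)) ->
  (forall i j, (fun n => A n i j) @ U --> L i j) -> stochastic L.
Proof.
move=> sA AL; split=> [i j|i].
  by apply: ultra_cvg_ge (AL i j) => n /sA[A0 _]; exact: A0.
have /(ultra_cvg_near_eq (g := cst 1) (N := N)) H := ultra_cvg_sum (AL i).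
have : cst 1 @ U --> \sum_j L i j by apply: H => n /sA[_ ->].
by move/cvg_lim => <- //; rewrite lim_cst.
Qed.

Lemma ultra_cvg_mulmxr m k l (A : nat -> 'M[R]_(m, k)) (L : 'M[R]_(m, k))
    (C : 'M[R]_(k, l)) :
  (forall i j, (fun n => A n i j) @ U --> L i j) ->
  forall i j, (fun n => (A n *m C) i j) @ U --> (L *m C) i j.
Proof.
move=> AL i j; rewrite mxE.
under eq_fun do rewrite mxE.
by apply: ultra_cvg_sum => h; apply: cvgMl; exact: AL.
Qed.

End UltraLimits.

(** * Simplices of invariant measures *)

Section Simplex.
Variables (R : realType) (B : bratteli) (k : nat).
Variable mu : 'I_k -> probability (path_borel B) R.
Hypothesis mu_invariant : forall i, invariant_measure (mu i).
Hypothesis mu_free : forall t : 'I_k -> R,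
  (forall E, measurable E -> \sum_i t i * mass (mu i) E = 0) ->
  forall i, t i = 0.
Hypothesis mu_span : forall m : {finite_measure set (path_borel B) -> \bar R},
  invariant m -> exists2 t : 'I_k -> R, (forall i, 0 <= t i) &
    forall E, measurable E -> mass m E = \sum_i t i * mass (mu i) E.

(** For a tail invariant [D], [mu i] is the sum of its restrictions to [D] and
    to the complement, two invariant measures.  As [mu i] is a vertex, both are
    multiples of it; a restriction of [mu i] that is a multiple of [mu i] has
    the factor [0] or [1]. *)
Lemma simplex_vertex_ergodic i : ergodic_measure (mu i).
Proof.
move=> D mD tD.
have mid := @measurable_id _ (path_borel B) setT.
have [m mE] := transport_measure (mu i) mD mid.
have [m' mE'] := transport_measure (mu i) (measurableC mD) mid.
have im : invariant m.
  exact: (invariant_restriction (mu_invariant i) mD tD).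
have im' : invariant m'.
  exact: (invariant_restriction (mu_invariant i) (measurableC mD)
    (tail_invariantC tD)).
have [t t0 tE] := mu_span im; have [s s0 sE] := mu_span im'.
have mm' E : measurable E -> mass m E + mass m' E = mass (mu i) E.
  move=> mEE; apply: EFin_inj; rewrite EFinD -!massE // mE mE' !preimage_id.
  by rewrite ![_ `&` E]setIC -setDE addeC; symmetry; exact: measureDI.
have ts l : t l + s l - (l == i)%:R = 0.
  apply: (mu_free (t := fun l => t l + s l - (l == i)%:R)) => E mEE.
  rewrite (eq_bigr (fun l => (t l * mass (mu l) E + s l * mass (mu l) E)
    + - ((l == i)%:R * mass (mu l) E))); last first.
    by move=> j _; rewrite mulrBl mulrDl.
  rewrite !big_split /= -tE // -sE // mm' // sumrN (bigD1 i) //= eqxx mul1r.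
  by rewrite big1 ?addr0 ?subrr // => j /negPf ->; rewrite mul0r.
have tl l : l != i -> t l = 0.
  move=> /negPf li; have := ts l; have := t0 l; have := s0 l.
  by rewrite li subr0; lra.
have mti E : measurable E -> mass (mu i) (D `&` E) = t i * mass (mu i) E.
  move=> mEE; rewrite -[LHS](_ : mass m E = _); last by rewrite /mass mE.
  rewrite tE // (bigD1 i) //= big1 ?addr0 // => l li.
  by rewrite tl // mul0r.
(* [setT] gives [mu i D = t i], and [D] gives [mu i D = t i * mu i D] *)
have := mti _ mD; have := mti _ measurableT; rewrite setIT setIid mass_setT.
rewrite mulr1 => <- /eqP.
rewrite -subr_eq0 -{1}[mass _ _]mulr1 -mulrBr mulf_eq0.
have toE (a : R) : mass (mu i) D = a -> mu i D = a%:E.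
  by move=> <-; exact: massE.
by case/orP => [/eqP/toE|]; [left|rewrite subr_eq0 => /eqP/esym/toE; right].
Qed.

(** An ergodic [nu] other than the vertices vanishes on sets of full measure
    for each of them, which forces its coefficients on them to be [0]. *)
Lemma simplex_exactly_ergodic : exactly_ergodic_invariant R B k.
Proof.
exists mu; split=> [i|i j same|nu inu enu].
- by split; [exact: mu_invariant|exact: simplex_vertex_ergodic].
- have /(_ i) : forall l, (l == i)%:R - (l == j)%:R = 0 :> R.
    apply: mu_free => E mE.
    have mass_delta (h : 'I_k) :
        \sum_l (l == h)%:R * mass (mu l) E = mass (mu h) E.
      rewrite (bigD1 h) //= eqxx mul1r big1 ?addr0 // => l /negPf ->.
      by rewrite mul0r.
    under eq_bigr do rewrite mulrBl.
    rewrite big_split /= sumrN !mass_delta; apply/eqP; rewrite subr_eq0.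
    by apply/eqP; apply: probability_mass; rewrite same // massE.
  by rewrite eqxx; case: eqP => // _ /eqP; rewrite subr0 oner_eq0.
apply: contrapT => nex.
have dist i : ~ same_measure nu (mu i) by move=> H; apply: nex; exists i.
have [t t0 tE] := mu_span inu.
have ti i : t i = 0.
  have [D [mD _ D0 D1]] := ergodic_separated inu (mu_invariant i) enu
    (@simplex_vertex_ergodic i) (@dist i).
  have := tE D mD; rewrite (probability_mass D0) => /esym/eqP.
  rewrite psumr_eq0 => [/allP/(_ i (mem_index_enum _))|l _]; last first.
    by rewrite mulr_ge0 // mass_ge0.
  by rewrite /= (probability_mass D1) mulr1 => /eqP.
have := tE _ measurableT; rewrite mass_setT big1 => [/eqP|i _].
  by rewrite oner_eq0.
by rewrite ti mul0r.
Qed.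

End Simplex.

(** * Invariant measures as sequences of distributions *)

Lemma sum_option (V : nmodType) (I : finType) (F : option I -> V) :
  \sum_o F o = F None + \sum_i F (Some i).
Proof.
rewrite (bigD1 None) //= (reindex_omap Some id) /=; last by case.
by congr (_ + _); apply: eq_bigl => i; rewrite eqxx.
Qed.

Section VertexWeights.
Variables (R : realType) (B : bratteli).
Implicit Types (m : {finite_measure set (path_borel B) -> \bar R}).

Lemma sum_out_edges n (w : level B n) (g : level B n.+1 -> R) :
  \sum_(e : edges B n | src e == w) g (rng e) =
  \sum_(v : level B n.+1) (incidence v w)%:R * g v.
Proof.
rewrite (partition_big (@rng B n) predT) //=; apply: eq_bigr => v _.
rewrite (eq_bigr (fun=> g v)); last by move=> e /andP[_ /eqP->].
rewrite sumr_const mulr_natl; congr (_ *+ _).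
apply: eq_card => e.
by rewrite !inE andbC.
Qed.

Definition vertex_path n (v : level B n) : path_space B :=
  sval (cid (path_through v)).

Lemma vertex_pathP n (v : level B n) : path_vertex (vertex_path v) n = v.
Proof. exact: svalP (cid (path_through v)). Qed.

(** For an invariant measure, the mass of any cylinder that ends at [v]. *)
Definition vertex_mass m n (v : level B n) : R :=
  mass m (cylinder (vertex_path v) n).

Lemma vertex_massE m n x : invariant m ->
  vertex_mass m (path_vertex x n) = mass m (cylinder x n).
Proof.
by move=> im; rewrite /vertex_mass /mass (im _ _ x) // vertex_pathP.
Qed.

Lemma vertex_mass_step m n (w : level B n) : invariant m ->
  vertex_mass m w =
  \sum_(v : level B n.+1) (incidence v w)%:R * vertex_mass m v.
Proof.
move=> im; rewrite -sum_out_edges /vertex_mass -[cylinder _ n]setTI.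
rewrite mass_step // /step vertex_pathP; apply: eq_bigr => e /eqP se.
have sv : src e = path_vertex (vertex_path w) n by rewrite vertex_pathP.
by rewrite setTI -(path_vertex_ext sv) -/(vertex_mass _ _) vertex_massE.
Qed.

End VertexWeights.

Section Diagram.
Variables (R : realType) (k : nat) (B : bratteli).
Variable lbl : forall n, 'I_k -> level B n.
Variable r : nat -> nat.
Hypothesis lbl_bij : forall n, (1 <= n)%N -> bijective (lbl n).
Hypothesis row_sum : forall n (v : level B n.+1),
  (\sum_(w : level B n) incidence v w)%N = r n.
Hypothesis rank_incidence : forall n, (1 <= n)%N ->
  \rank (incidence_mx R lbl n) = k.
Implicit Types (m : {finite_measure set (path_borel B) -> \bar R}).

Lemma row_sum_gt0 n : (0 < r n)%N.
Proof.
pose e := edge (point : path_space B) n.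
rewrite -(row_sum (rng e)) (bigD1 (src e)) //= addn_gt0; apply/orP; left.
by apply/card_gt0P; exists e; rewrite !inE !eqxx.
Qed.

Lemma row_sumr_neq0 n : (r n)%:R != 0 :> R.
Proof. by rewrite pnatr_eq0 -lt0n row_sum_gt0. Qed.

Lemma sum_level n (f : level B n.+1 -> R) :
  \sum_(v : level B n.+1) f v = \sum_(i < k) f (lbl n.+1 i).
Proof.
have bij : bijective (lbl n.+1) by exact: lbl_bij.
rewrite (reindex (lbl n.+1)) //; exact: onW_bij.
Qed.

Definition transition n : 'M[R]_k := (r n)%:R^-1 *: incidence_mx R lbl n.

Lemma transition_row_sum n i : \sum_j transition n.+1 i j = 1.
Proof.
under eq_bigr do rewrite !mxE.
rewrite -mulr_sumr -(sum_level (fun w => (incidence (lbl n.+2 i) w)%:R)).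
by rewrite -natr_sum row_sum mulVf ?row_sumr_neq0.
Qed.

Lemma transition_stochastic n : stochastic (transition n.+1).
Proof.
split; last exact: transition_row_sum.
by move=> i j; rewrite !mxE mulr_ge0 ?invr_ge0 ?ler0n.
Qed.

Lemma z_detE n : z_det R lbl r n.+1 = \det (transition n.+1).
Proof.
rewrite -(det_last_col1 (transition_row_sum n)) /z_det; congr (\det _).
by apply/matrixP => i j; rewrite !mxE mulrC.
Qed.

Lemma transition_unit n : transition n.+1 \in unitmx.
Proof.
by rewrite -row_free_unit /row_free mxrank_scale_nz ?rank_incidence //
  invr_eq0 row_sumr_neq0.
Qed.

Lemma z_det_in01 n : (1 <= n)%N -> 0 < `|z_det R lbl r n| <= 1.
Proof.
case: n => // n _; rewrite z_detE normr_gt0 -unitfE -unitmxE transition_unit.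
exact/stochastic_det_le1/transition_stochastic.
Qed.

(** A distribution on level [n.+1] induces the distribution
    [q *m descent n] on level [1]; the levels with [k] vertices start at [1]. *)
Fixpoint descent n : 'M[R]_k :=
  if n is n'.+1 then transition n *m descent n' else 1%:M.

Lemma descent_unit n : descent n \in unitmx.
Proof.
by elim: n => [|n IH] /=; rewrite ?unitmx1 // unitmx_mul transition_unit.
Qed.

Lemma descent_det n :
  `|\det (descent n)| = \prod_(1 <= j < n.+1) `|z_det R lbl r j|.
Proof.
elim: n => [|n IH]; first by rewrite det1 normr1 big_geq.
by rewrite big_nat_recr //= -IH z_detE det_mulmx normrM mulrC.
Qed.

Lemma descent_ratio_stochastic n l : (n <= l)%N ->
  stochastic (descent l *m invmx (descent n)).
Proof.
move=> nl; rewrite -(subnK nl); elim: (l - n)%N => [|j IH].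
  by rewrite add0n mulmxV ?descent_unit //; exact: stochastic1.
rewrite addSn /= -mulmxA; apply: stochasticM => //.
exact: transition_stochastic.
Qed.

Lemma descent_stochastic n : stochastic (descent n).
Proof.
by have := @descent_ratio_stochastic 0 n isT; rewrite invmx1 mulmx1.
Qed.

(** Number of paths from the root to any vertex of level [n]. *)
Definition height n : R := \prod_(0 <= j < n) (r j)%:R.

Lemma heightS n : height n.+1 = height n * (r n)%:R.
Proof. by rewrite /height big_nat_recr. Qed.

Lemma height_neq0 n : height n != 0.
Proof. by rewrite prodf_seq_neq0; apply/allP => j _; exact: row_sumr_neq0. Qed.

Lemma height_gt0 n : 0 < height n.
Proof. by apply: prodr_gt0 => j _; rewrite ltr0n row_sum_gt0. Qed.

(** The distribution on level [n.+1] of the vertex visited by a random path: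
    each vertex is the end of [height n.+1] cylinders of the same mass. *)
Definition level_distr m n : 'rV[R]_k :=
  \row_i (height n.+1 * vertex_mass m (lbl n.+1 i)).

Lemma level_distr_ge0 m n i : 0 <= level_distr m n 0 i.
Proof. by rewrite mxE mulr_ge0 ?(ltW (height_gt0 _)) ?mass_ge0. Qed.

Lemma level_distr_step m n : invariant m ->
  level_distr m n = level_distr m n.+1 *m transition n.+1.
Proof.
move=> im; apply/rowP => i.
rewrite !mxE vertex_mass_step // sum_level mulr_sumr.
apply: eq_bigr => j _; rewrite !mxE (heightS n.+1).
by field; exact: row_sumr_neq0.
Qed.

Lemma level_distr0 m n : invariant m ->
  level_distr m 0 = level_distr m n *m descent n.
Proof.
move=> im; elim: n => [|n IH] /=; first by rewrite mulmx1.
by rewrite IH (level_distr_step n im) mulmxA.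
Qed.

Lemma level_distrE m n : invariant m ->
  level_distr m n = level_distr m 0 *m invmx (descent n).
Proof. by move=> im; rewrite (level_distr0 n im) mulmxK ?descent_unit. Qed.

Lemma height_vertex_mass m n : invariant m ->
  height n * \sum_(v : level B n) vertex_mass m v = mass m setT.
Proof.
move=> im; elim: n => [|n <-].
  rewrite /height big_geq // mul1r (bigD1 (path_vertex point 0)) //= big1.
    by rewrite addr0 vertex_massE // cylinder0.
  by move=> v; rewrite (level0_eq v (path_vertex point 0)) eqxx.
rewrite heightS -mulrA; congr (_ * _).
under [RHS]eq_bigr do rewrite vertex_mass_step //.
rewrite exchange_big /= mulr_sumr; apply: eq_bigr => v _.
by rewrite -mulr_suml -natr_sum row_sum.
Qed.

Lemma level_distr_sum m n : invariant m ->
  \sum_i level_distr m n 0 i = mass m setT.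
Proof.
move=> im; rewrite -(height_vertex_mass n.+1 im) sum_level mulr_sumr.
by apply: eq_bigr => i _; rewrite mxE.
Qed.

Lemma level_distr_le m n i : invariant m ->
  level_distr m n 0 i <= mass m setT.
Proof.
move=> im; rewrite -(level_distr_sum n im) (bigD1 i) //= lerDl.
by apply: sumr_ge0 => j _; exact: level_distr_ge0.
Qed.

Lemma lbl_surj n (v : level B n.+1) : exists i, lbl n.+1 i = v.
Proof. by have [g _ gK] := lbl_bij (ltn0Sn n); exists (g v). Qed.

(** Linear relations between invariant measures can be read off their
    distributions on level [1]: the transition matrices being invertible, they
    propagate to all levels. *)
Lemma level_distr_combination (I : finType)
    (m : I -> {finite_measure set (path_borel B) -> \bar R}) (c : I -> R) :
  (forall i, invariant (m i)) ->
  \sum_i c i *: level_distr (m i) 0 = 0 ->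
  forall E, measurable E -> \sum_i c i * mass (m i) E = 0.
Proof.
move=> im c0; apply: (mass_combination_eq0 (N := 1%N)) => -[//|n] x _.
have [j jx] := lbl_surj (path_vertex x n.+1).
apply: (mulfI (height_neq0 n.+1)); rewrite mulr0 mulr_sumr.
have : (\sum_i c i *: level_distr (m i) n) 0 j = 0.
  under eq_bigr do rewrite level_distrE // scalemxAl.
  by rewrite -mulmx_suml c0 mul0mx mxE.
rewrite summxE => H; rewrite -[RHS]H; apply: eq_bigr => i _.
rewrite !mxE jx vertex_massE //.
by rewrite mulrCA.
Qed.


(** * From ergodic measures to the product and back *)

(** A linear relation between the rows is a relation between the measures.
    Evaluated on a set that is null for [mu i0] and of full measure for the
    others, and on the whole space, it gives [u i0 = 0]. *)
Lemma ergodic_level_distr_free (mu : 'I_k -> probability (path_borel B) R) :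
  (forall i, invariant_measure (mu i) /\ ergodic_measure (mu i)) ->
  (forall i j, same_measure (mu i) (mu j) -> i = j) ->
  (\matrix_i level_distr (mu i) 0 : 'M[R]_k) \in unitmx.
Proof.
move=> ie inj; rewrite -row_free_unit; apply: inj_row_free => u.
rewrite mulmx_sum_row => u0.
have comb E : measurable E -> \sum_i u 0 i * mass (mu i) E = 0.
  apply: level_distr_combination => [i|]; first by have [] := ie i.
  by rewrite -[RHS]u0; apply: eq_bigr => i _; rewrite rowK.
apply/rowP => i0; rewrite mxE.
have sep (l : 'I_k) : exists D : set (path_borel B), l != i0 ->
    [/\ measurable D, mu i0 D = 0%E & mu l D = 1%E].
  have [->|li] := eqVneq l i0; first by exists set0.
  have [i1 e1] := ie i0; have [i2 e2] := ie l.
  have [|D [mD _ D0 D1]] := ergodic_separated i1 i2 e1 e2.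
    by move=> /inj E; rewrite E eqxx in li.
  by exists D.
pose D (l : 'I_k) : set (path_borel B) := sval (cid (sep l)).
have DP l : l != i0 ->
    [/\ measurable (D l), mu i0 (D l) = 0%E & mu l (D l) = 1%E].
  exact: svalP (cid (sep l)).
pose DU : set (path_borel B) := \big[setU/set0]_(l | l != i0) D l.
have mDU : measurable DU by apply: bigsetU_measurable => l /DP[].
have mass0 : mass (mu i0) DU = 0.
  suff [_ D0] : measurable DU /\ mu i0 DU = 0%E by exact: probability_mass.
  apply: (big_ind (fun E : set (path_borel B) =>
    measurable E /\ mu i0 E = 0%E)).
  - by rewrite measure0.
  - move=> E F [mE E0] [mF F0]; split; first exact: measurableU.
    by rewrite measureU0 ?E0.
  - by move=> l /DP[].
have mass1 l : l != i0 -> mass (mu l) DU = 1.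
  move=> li; have [mD _ D1] := DP l li.
  apply/eqP; rewrite eq_le -!lee_fin -!massE //; apply/andP; split.
    exact: probability_le1.
  rewrite -[X in (X <= _)%E]D1; apply: le_measure; rewrite ?inE //.
  by rewrite /DU (bigD1 l) //=; left.
have HT : u 0 i0 + \sum_(l | l != i0) u 0 l = 0.
  rewrite -[RHS](comb _ measurableT) [RHS](bigD1 i0) //= mass_setT mulr1.
  by congr (_ + _); apply: eq_bigr => l _; rewrite mass_setT mulr1.
have HD : \sum_(l | l != i0) u 0 l = 0.
  rewrite -[RHS](comb _ mDU) [RHS](bigD1 i0) //= mass0 mulr0 add0r.
  by apply: eq_bigr => l li; rewrite mass1 // mulr1.
by rewrite HD addr0 in HT.
Qed.

(** The rows on level [1] are those on level [n.+1], a stochastic matrix, times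
    [descent n]. *)
Lemma ergodic_prod_ge (mu : 'I_k -> probability (path_borel B) R) n :
  (forall i, invariant_measure (mu i)) ->
  `|\det (\matrix_i level_distr (mu i) 0 : 'M[R]_k)| <=
  \prod_(1 <= j < n.+1) `|z_det R lbl r j|.
Proof.
move=> im; rewrite -descent_det.
pose M : 'M[R]_k := \matrix_i level_distr (mu i) n.
have -> : (\matrix_i level_distr (mu i) 0 : 'M[R]_k) = M *m descent n.
  by apply/row_matrixP => i; rewrite row_mul !rowK -level_distr0 //; exact: im.
rewrite det_mulmx normrM ler_piMl //; apply: stochastic_det_le1.
split=> [i j|i].
  by rewrite mxE level_distr_ge0.
under eq_bigr do rewrite mxE.
by rewrite level_distr_sum ?mass_setT //; exact: im.
Qed.

Section Limit.
Hypothesis path_compact : compact [set: path_space B].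
Variable c : R.
Hypothesis c_gt0 : 0 < c.
Hypothesis prod_ge : forall n, c <= \prod_(1 <= j < n.+1) `|z_det R lbl r j|.

(** A limit point [A] of the matrices [descent n]: as the determinants stay
    away from [0] it is invertible, and [A *m invmx (descent n)], a limit of
    transition probabilities from far levels to level [n.+1], is stochastic. *)
Lemma descent_limit : exists (U : set_system nat) (A : 'M[R]_k),
  [/\ UltraFilter U, \oo `<=` U,
      forall i j, (fun n => descent n i j) @ U --> A i j, A \in unitmx &
      forall n, stochastic (A *m invmx (descent n))].
Proof.
have [U [UU subU]] := @ultraFilterLemma _ (\oo : set_system nat) _.
have entry i j : exists l : R, (fun n => descent n i j) @ U --> l.
  apply: (@bounded_ultra_cvg _ _ _ _ 0 1) => n.
  have [d0 d1] := descent_stochastic n; rewrite d0 /= -(d1 i) (bigD1 j) //=.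
  by rewrite lerDl sumr_ge0.
pose A : 'M[R]_k := \matrix_(i, j) sval (cid (entry i j)).
have AU i j : (fun n => descent n i j) @ U --> A i j.
  by rewrite mxE; exact: svalP (cid (entry i j)).
exists U, A; split=> //.
  rewrite unitmxE unitfE -normr_gt0; apply: lt_le_trans c_gt0 _.
  have dU : (fun n => `|\det (descent n)|) @ U --> `|\det A|.
    by apply: cvg_norm; exact: ultra_cvg_det.
  by apply: (ultra_cvg_ge subU (N := 0%N) _ dU) => n _; rewrite descent_det.
move=> n; apply: (@ultra_cvg_stochastic _ U _ subU _
  (fun l => descent l *m invmx (descent n)) _ n) => [l|].
  exact: descent_ratio_stochastic.
exact: ultra_cvg_mulmxr.
Qed.

(** The weight of a vertex is its probability divided by the number of paths
    that reach it; at the root it is [1]. *)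
Lemma distr_measure (q : nat -> 'rV[R]_k) :
  (forall n i, 0 <= q n 0 i) -> (forall n, q n = q n.+1 *m transition n.+1) ->
  \sum_i q 0 0 i = 1 ->
  exists mu : probability (path_borel B) R,
    invariant_measure mu /\ forall n, level_distr mu n = q n.
Proof.
move=> q0 qS q1.
pose p n : level B n -> R :=
  if n is n'.+1 then
    fun v => \sum_(i | lbl n'.+1 i == v) q n' 0 i / height n'.+1
  else fun=> 1.
have pE n i : p n.+1 (lbl n.+1 i) = q n 0 i / height n.+1.
  rewrite /p (bigD1 i) //= big1 ?addr0 // => j /andP[/eqP + ji].
  have inj : injective (lbl n.+1) by exact/bij_inj/lbl_bij.
  by move/inj => E; rewrite E eqxx in ji.
have [|||mu muE] := @weights_probability R B path_compact p.
- move=> [|n] v //=; apply: sumr_ge0 => i _.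
  by rewrite divr_ge0 // ltW // height_gt0.
- by [].
- move=> [|n] w; rewrite sum_out_edges sum_level.
    rewrite /= -[LHS]q1; apply: eq_bigr => i _; rewrite -/(p 1%N _) pE.
    have -> : incidence (lbl 1 i) w = r 0.
      rewrite -(row_sum (lbl 1 i)) (bigD1 w) //= big1 ?addn0 // => v.
      by rewrite (level0_eq v w) eqxx.
    by rewrite /height big_nat1; field; exact: row_sumr_neq0.
  have [i <-] := lbl_surj w; rewrite pE qS mxE mulr_suml.
  apply: eq_bigr => j _; rewrite pE !mxE (heightS n.+1).
  by field; rewrite row_sumr_neq0 height_neq0.
have im : invariant_measure mu by move=> n x y xy; rewrite !muE xy.
exists mu; split=> // n; apply/rowP => i; rewrite mxE.
have -> : vertex_mass mu (lbl n.+1 i) = q n 0 i / height n.+1.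
  apply: EFin_inj; rewrite -massE; last exact: cylinder_measurable.
  by apply: etrans (muE _ _) _; rewrite vertex_pathP pE.
by field; exact: height_neq0.
Qed.

(** The vertices of the simplex are the measures whose distribution on level [1]
    is a row of the limit [A]; the coefficients of an invariant measure on them
    are the limits of its distributions on the levels. *)
Lemma exactly_ergodic_of_prod : exactly_ergodic_invariant R B k.
Proof.
have [U [A [UU subU AU Aunit sA]]] := descent_limit.
have PU : ProperFilter U by exact: ultra_proper.
pose Q n := A *m invmx (descent n).
have ex i : exists mu : probability (path_borel B) R,
    invariant_measure mu /\ forall n, level_distr mu n = row i (Q n).
  apply: distr_measure => [n j|n|].
  - by rewrite mxE; have [] := sA n.
  - rewrite -row_mul; congr row; rewrite /Q -mulmxA; congr (_ *m _).
    have dS := descent_unit n.+1.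
    apply: (can_inj (mulmxK (descent_unit n))).
    rewrite mulVmx ?descent_unit // -mulmxA -/(descent n.+1).
    by rewrite mulVmx.
  - by under eq_bigr do rewrite mxE; have [] := sA 0%N.
pose mu i := sval (cid (ex i)).
have imu i : invariant_measure (mu i) by have [] := svalP (cid (ex i)).
have qmu i n : level_distr (mu i) n = row i (Q n).
  by have [_] := svalP (cid (ex i)).
have Q0 : Q 0%N = A by rewrite /Q /= invmx1 mulmx1.
apply: (simplex_exactly_ergodic (mu := mu)) => // [t t0|m im].
  pose u : 'rV[R]_k := \row_i t i.
  suff u0 : u = 0 by move=> i; have := congr1 (fun v : 'rV[R]_k => v 0 i) u0;
    rewrite !mxE.
  apply: (can_inj (mulmxK Aunit)); rewrite mul0mx mulmx_sum_row.
  apply/rowP => j; rewrite [RHS]mxE summxE.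
  have mC :
      measurable (cylinder (vertex_path (lbl 1 j)) 1 : set (path_borel B)).
    exact: cylinder_measurable.
  apply: etrans (etrans (congr1 ( *%R (height 1)) (t0 _ mC)) (mulr0 _)).
  rewrite mulr_sumr; apply: eq_bigr => i _.
  by rewrite -Q0 -qmu !mxE /vertex_mass; ring.
have entry i : exists l : R, (fun n => level_distr m n 0 i) @ U --> l.
  apply: (@bounded_ultra_cvg _ _ _ _ 0 (mass m setT)) => n.
  by rewrite level_distr_ge0 level_distr_le.
pose t i := sval (cid (entry i)).
have tU i : (fun n => level_distr m n 0 i) @ U --> t i.
  exact: svalP (cid (entry i)).
(* limit of [level_distr m 0 = level_distr m n *m descent n] *)
have tA j : level_distr m 0 0 j = \sum_i t i * A i j.
  have H1 : (fun n => (level_distr m n *m descent n) 0 j) @ U -->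
      \sum_i t i * A i j.
    under eq_fun do rewrite mxE.
    by apply: ultra_cvg_sum => i; apply: cvgM; [exact: tU|exact: AU].
  have H2 : (fun n => (level_distr m n *m descent n) 0 j) @ U -->
      level_distr m 0 0 j.
    by under eq_fun do rewrite -level_distr0 //; exact: cvg_cst.
  have L1 := cvg_lim (@norm_hausdorff _ R) H1.
  by have := cvg_lim (@norm_hausdorff _ R) H2; rewrite L1 => ->.
exists t => [i|E mE].
  apply: (ultra_cvg_ge subU (N := 0%N) _ (tU i)) => n _.
  exact: level_distr_ge0.
pose m' (o : option 'I_k) : {finite_measure set (path_borel B) -> \bar R} :=
  if o is Some i then mu i else m.
pose d (o : option 'I_k) : R := if o is Some i then t i else -1.
have := @level_distr_combination _ m' d _ _ E mE.
rewrite !sum_option /= mulN1r => H; apply/eqP.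
rewrite -subr_eq0 -oppr_eq0 opprB addrC; apply/eqP; apply: H.
  by case=> [i|]; [exact: imu|].
apply/rowP => j; rewrite scaleN1r [LHS]mxE [X in X + _]mxE tA summxE mxE.
rewrite addrC; apply/eqP; rewrite subr_eq0; apply/eqP. apply: eq_bigr => i _.
by rewrite qmu Q0 !mxE.
Qed.

End Limit.

End Diagram.

Theorem theorem3p7 (R : realType) (k : nat) (hk : (2 <= k)%N) (B : bratteli)
  (hCantor : cantor_like (path_space B))
  (lbl : forall n, 'I_k -> level B n)
  (hlbl : forall n, (1 <= n)%N -> bijective (lbl n))
  (r : nat -> nat)
  (hrow : forall n (v : level B n.+1),
    (\sum_(w : level B n) incidence v w)%N = r n)
  (hr : forall n, (1 <= n)%N -> (2 <= r n)%N)
  (hrank : forall n, (1 <= n)%N -> \rank (incidence_mx R lbl n) = k) :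
  (exactly_ergodic_invariant R B k <->
    exists2 p : R, 0 < p &
      (\prod_(1 <= n < N) `|z_det R lbl r n|) @[N --> \oo] --> p) /\
  ((exists2 p : R, 0 < p &
      (\prod_(1 <= n < N) `|z_det R lbl r n|) @[N --> \oo] --> p) <->
    cvgn (fun N => \sum_(1 <= n < N) (1 - `|z_det R lbl r n|) : R)).
Proof.
have z01 n : (1 <= n)%N -> 0 < `|z_det R lbl r n| <= 1 by exact: z_det_in01.
have z01' n : (1 <= n)%N -> 0 <= `|z_det R lbl r n| <= 1.
  by move=> /z01/andP[/ltW -> ->].
have [_ cpt _ _] := hCantor.
split; last exact: prod_cvg_posP.
split=> [[mu [ie inj _]]|[p p0 cp]]; last first.
  apply: (exactly_ergodic_of_prod hlbl hrow hrank cpt p0) => n.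
  exact: prod_le_cvg.
have Munit := ergodic_level_distr_free hlbl hrow hrank ie inj.
have im i : invariant_measure (mu i) by have [] := ie i.
apply: (prod_cvg_pos z01' _
  (c := `|\det (\matrix_i level_distr lbl r (mu i) 0)|)).
  by rewrite normr_gt0 -unitfE -unitmxE.
move=> N; apply: le_trans (ergodic_prod_ge hlbl hrow N.-1 im) _.
by case: N => [|N] //; rewrite !big_geq.
Qed.
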